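(* Let $X$ be a Polish space and let $G$ be a locally finite Borel graph on $X$ such that $\chi(G) < \aleph_0$, and such that every connected component of $G$ has two ends. Then $\chi_B(G) \leq 2\chi(G) - 1$.
   Context: A graph on a set $X$ is a symmetric irreflexive relation $G \subset X \times X$; the elements of $X$ are its vertices, and vertices $x,y$ are adjacent if $(x,y)\in G$. $G$ is locally finite if every vertex is adjacent to only finitely many vertices. A connected component of $G$ is an equivalence class of the equivalence relation on $X$ generated by $G$; $G$ is connected if it has one connected component. For $A\subset X$, $G \upharpoonright A$ denotes the graph $G\cap (A\times A)$ on $A$. Ends: for a connected locally finite graph $G$ on a set $X$, a subset $F\subset X$ divides $G$ into $n$ parts if $G\upharpoonright (X-F)$ has $n$ infinite connected components. $G$ has $n$ ends if there is a finite set $F$ dividing $G$ into $n$ parts, but no finite set $F$ dividing $G$ into $m$ parts for any $m>n$. A connected component $C$ of a locally finite graph $G$ has two ends if the connected graph $G\upharpoonright C$ has two ends. A (proper) coloring of $G$ is a function $c:X\to Y$ to some set $Y$ with $c(x)\neq c(y)$ whenever $x,y$ are adjacent; it is a $k$-coloring if $|Y|=k$. The chromatic number $\chi(G)$ is the least $k$ such that $G$ admits a $k$-coloring. When $X$ is a Polish space, $G$ is Borel if it is a Borel subset of the product space $X\times X$. A coloring $c:X\to Y$ is Borel if $Y$ is also a Polish space and $c$ is a Borel function. The Borel chromatic number $\chi_B(G)$ is the least $k$ such that $G$ admits a Borel $k$-coloring. *)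

(* Defs.v *)
From Stdlib Require Import Relation_Operators.
From mathcomp Require Import all_boot all_order all_algebra.
From mathcomp Require Import all_classical all_reals all_analysis.

Set Implicit Arguments.
Unset Strict Implicit.
Unset Printing Implicit Defensive.

Local Open Scope classical_set_scope.

(** * Polish spaces and Borel sets *)

Definition separable (T : topologicalType) : Prop :=
  exists2 D : set T, countable D & dense D.

(* The axiom of [completeType], without its requirement that the type be
   pointed: empty spaces are allowed. *)
Definition complete_metric (R : realType) (M : metricType R) : Prop :=
  forall F : set_system M, ProperFilter F -> cauchy F -> exists l : M, F --> l.

Definition homeomorphic (S T : topologicalType) : Prop :=
  exists (f : S -> T) (g : T -> S),
    [/\ continuous f, continuous g, cancel f g & cancel g f].

(* Complete metrizability is a property of the topology of [T]: no metric is
   chosen. [R] is only the type in which distances take their values. *)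
Definition polish (R : realType) (T : topologicalType) : Prop :=
  separable T /\
  exists2 M : metricType R, complete_metric M & homeomorphic T M.

(* The library's [measurableType]s are pointed, so Borel sets are taken directly
   from the generated sigma-algebra. *)
Definition borel (T : topologicalType) : set (set T) := <<s @open T >>.

Definition borel_fun (S T : topologicalType) (f : S -> T) : Prop :=
  forall B : set T, borel B -> borel (f @^-1` B).

(** * Graphs *)

Section Graphs.
Variable X : Type.
Implicit Types (G : set (X * X)) (A F C : set X).

Definition is_graph G : Prop :=
  (forall x y, G (x, y) -> G (y, x)) /\ (forall x, ~ G (x, x)).

Definition locally_finite G : Prop :=
  forall x, finite_set [set y | G (x, y)].

Definition restrict_graph G A : set (X * X) := G `&` (A `*` A).

(* The connected components of a graph [G] with vertex set [A], where
   [G `<=` A `*` A]: the generated equivalence relation then relates a point of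
   [A] only to points of [A], and an isolated vertex is a component. *)
Definition components A G : set (set X) :=
  [set [set y | clos_refl_sym_trans X (fun u v => G (u, v)) x y] | x in A].

(* In the next two definitions [G] is again a graph with vertex set [A]. *)
Definition divides A G F (n : nat) : Prop :=
  ([set C | components (A `\` F) (restrict_graph G (A `\` F)) C /\
            infinite_set C] #= `I_n)%card.

Definition has_ends A G (n : nat) : Prop :=
  (exists F, [/\ finite_set F, F `<=` A & divides A G F n]) /\
  (forall m : nat, (n < m)%N ->
     ~ exists F, [/\ finite_set F, F `<=` A & divides A G F m]).

Definition component_has_ends G C (n : nat) : Prop :=
  has_ends C (restrict_graph G C) n.

(** * Colorings *)

Definition coloring (Y : Type) G (c : X -> Y) : Prop :=
  forall x y, G (x, y) -> c x <> c y.

Definition colorable G (k : nat) : Prop :=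
  exists (Y : Type) (c : X -> Y), ([set: Y] #= `I_k)%card /\ coloring G c.

End Graphs.

Definition borel_colorable (R : realType) (X : topologicalType)
    (G : set (X * X)) (k : nat) : Prop :=
  exists (Y : topologicalType) (c : X -> Y),
    [/\ polish R Y, ([set: Y] #= `I_k)%card, coloring G c & borel_fun c].

Definition is_least (P : nat -> Prop) (k : nat) : Prop :=
  P k /\ forall j : nat, P j -> (k <= j)%N.

(* "chi(G) is finite and equal to k"; likewise for the Borel version. *)
Definition chromatic_number (X : Type) (G : set (X * X)) (k : nat) : Prop :=
  is_least (colorable G) k.

Definition borel_chromatic_number (R : realType) (X : topologicalType)
    (G : set (X * X)) (k : nat) : Prop :=
  is_least (borel_colorable R G) k.

(* Main.v *)
Require Import Defs.
From HB Require Import structures.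
From Stdlib Require Import Relation_Operators.
From mathcomp Require Import all_boot all_order all_algebra.
From mathcomp Require Import all_classical all_reals all_analysis.
From mathcomp Require Import zify.

(** The coloring comes from a Borel set [A] that breaks every component into
    finite pieces: the graph induced on the complement of [A], and the graph
    induced on [A] and its neighbors, have only finite components. Each of the two
    has a Borel [k]-coloring ([finite_components_coloring]). With disjoint palettes
    they would give [2 k] colors; but one color can be shared by the two palettes,
    because a vertex outside [A] for which the shared color is forbidden can be
    given the color it has in the coloring of [A] and its neighbors
    ([shattering_coloring]). This saves one color.

    To find [A], take balls of a fixed radius that each leave at least two infinite
    components, centered at a Borel set of points so far apart that the balls do
    not interact. If the complement of the balls has finite components only, the
    union of the balls is as desired. An infinite component [K] of the complement
    touches only one ball: if it touched two, then [K] and the far sides of these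
    two balls would be three infinite components of the complement of a finite set.
    For the same reason at most two balls of a connected component are touched by
    such sets [K]. So the vertices of the balls that are adjacent to some [K] form a
    Borel set meeting the component in a finite nonempty set, and the distance from
    that set cuts the component into finite layers ([candidate_shatters]).

    Everything so far is carried out in a sigma-algebra that contains a countable
    family isolating points in finite sets and is closed under passing from a set
    of vertices to the set of their neighbors ([definable_coloring]). For the Borel
    sets of a Polish space the closure property is the theorem that finite-to-one
    continuous images of Borel sets are Borel ([borel_image]). A Borel set is coded
    by sequences of natural numbers ([coded_borel]); since fibers are finite, a
    separation theorem bounds the possible codes of the points above [y] by Borel
    functions of [y] ([novikov]); and then membership of [y] in the image is
    decided by a finitely branching tree, level by level. *)

Set Implicit Arguments.
Unset Strict Implicit.
Unset Printing Implicit Defensive.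
Import Order.TTheory GRing.Theory Num.Theory.

Local Open Scope classical_set_scope.

Lemma least_nat (P : nat -> Prop) : (exists n, P n) ->
  exists n, P n /\ forall m, P m -> (n <= m)%N.
Proof.
move=> [k Pk]; have ex : exists n, `[<P n>] by exists k; apply/asboolP.
case: (ex_minnP ex) => n /asboolP Pn nmin; exists n; split=> // m Pm.
by apply: nmin; apply/asboolP.
Qed.

(** * Paths and components of an induced subgraph *)

Section Connectivity.
Variables (X : choiceType) (G : set (X * X)).
Hypothesis Gsym : forall x y, G (x, y) -> G (y, x).
Implicit Types (W F S : set X) (x y z : X).

(** Only edges have to lie in [W], not the starting point: a point outside [W]
    is alone in its component, which spares many membership hypotheses. *)
Fixpoint reach W (m : nat) x : set X :=
  if m is m'.+1
  then reach W m' x `|`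
       [set z | exists2 y, reach W m' x y & [/\ G (y, z), W y & W z]]
  else [set x].

Definition conn W x : set X := [set y | exists m, reach W m x y].

Definition gball (m : nat) x : set X := reach setT m x.

Lemma reach_refl W m x : reach W m x x.
Proof. by elim: m => //= m IH; left. Qed.

Lemma reach_trans W m n x y z :
  reach W m x y -> reach W n y z -> reach W (m + n) x z.
Proof.
move=> xy; elim: n z => [|n IH] z /=; first by rewrite addn0 => ->.
by rewrite addnS => -[/IH ?|[u /IH xu uz]]; [left|right; exists u].
Qed.

Lemma reach_leq W m n x : (m <= n)%N -> reach W m x `<=` reach W n x.
Proof.
by move=> /subnKC <- y xy; apply: reach_trans xy (reach_refl _ _ _).
Qed.

Lemma reach_sym W m x y : reach W m x y -> reach W m y x.
Proof.
elim: m y => [|m IH] y /=; first by move=> ->.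
move=> [/IH|[u /IH ux [uy Wu Wy]]]; first by left.
have yu : reach W 1 y u by right; exists y => //; split=> //; apply: Gsym.
exact: (reach_trans yu ux).
Qed.

Lemma conn_refl W x : conn W x x.
Proof. by exists 0. Qed.
Hint Resolve conn_refl : core.

Lemma conn_trans W x y z : conn W x y -> conn W y z -> conn W x z.
Proof. by move=> [m xy] [n yz]; exists (m + n); apply: reach_trans yz. Qed.

Lemma conn_sym W x y : conn W x y -> conn W y x.
Proof. by move=> [m xy]; exists m; apply: reach_sym. Qed.

Lemma conn_edge W x y : G (x, y) -> W x -> W y -> conn W x y.
Proof. by move=> xy Wx Wy; exists 1; right; exists x. Qed.

(** The induction principle behind nearly every argument on components: a set
    that no edge of the subgraph leaves contains the whole component. *)
Lemma conn_closed W S x y :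
  (forall u v, G (u, v) -> W u -> W v -> conn W x u -> S u -> S v) ->
  conn W x y -> S x -> S y.
Proof.
move=> cl [m xy] Sx; elim: m y xy => [|m IH] y /=; first by move=> ->.
move=> [/IH//|[u xu [uy Wu Wy]]].
by apply: (cl _ _ uy Wu Wy) (IH _ xu); exists m.
Qed.

Lemma conn_in W x y : W x -> conn W x y -> W y.
Proof. by move=> Wx xy; apply: (@conn_closed W W x y _ xy Wx). Qed.

Lemma conn_sub W W' x :
  (forall y, conn W x y -> W y -> W' y) -> conn W x `<=` conn W' x.
Proof.
move=> sub y xy; apply: (@conn_closed W (conn W' x) x y _ xy) => //.
move=> u v uv Wu Wv xu xu'.
apply: conn_trans xu' (conn_edge uv _ _); first exact: sub.
exact/sub/Wv/(conn_trans xu)/conn_edge.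
Qed.

Lemma conn_mono W W' x : W `<=` W' -> conn W x `<=` conn W' x.
Proof. by move=> sub; apply: conn_sub => y _; apply: sub. Qed.

Lemma conn_setT W x y : conn W x y -> conn setT x y.
Proof. exact: conn_mono. Qed.

(** The last vertex before a path enters [F] is still connected to the start
    outside [F]; this is how components of the complement of [F] are seen to be
    adjacent to [F]. *)
Lemma conn_exit F x f : conn setT x f -> F f -> ~ F x ->
  exists w, [/\ conn (~` F) x w, ~ F w & exists2 g, F g & G (w, g)].
Proof.
move=> xf Ff Fx; apply: contrapT => no.
suff [] : ~ F f /\ conn (~` F) x f by [].
apply: (@conn_closed setT [set v | ~ F v /\ conn (~` F) x v] x f _ xf) => //.
move=> u v uv _ _ _ [Fu xu].
have Fv : ~ F v by move=> Fv; apply: no; exists u; split=> //; exists v.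
by split=> //; apply: conn_trans xu (conn_edge uv _ _).
Qed.

Lemma gball_conn m x y : gball m x y -> conn (gball m x) x y.
Proof.
elim: m y => [|m IH] y /=; first by move=> ->.
have mS : gball m x `<=` gball m.+1 x by apply: reach_leq.
move=> [/IH|[u xu [uy _ _]]]; first exact: conn_mono.
apply: conn_trans (conn_mono mS (IH _ xu)) (conn_edge uy _ _) => //.
  exact: mS.
by right; exists u.
Qed.

Hypothesis Gfin : locally_finite G.

Lemma finite_gball m x : finite_set (gball m x).
Proof.
elim: m => [|m IH]; first exact: finite_set1.
rewrite /gball /= finite_setU; split=> //.
apply: (@sub_finite_set _ _ (\bigcup_(y in gball m x) [set z | G (y, z)])).
  by move=> z [y xy [yz _ _]]; exists y.
exact: bigcup_finite.
Qed.

Lemma finite_sub_gball x F : finite_set F -> F `<=` conn setT x ->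
  exists m, F `<=` gball m x.
Proof.
move=> /finite_seqP[s ->] sub.
elim: s sub => [|y s IH] sub; first by exists 0 => y; rewrite /= in_nil.
have [m sm] : exists m, [set` s] `<=` gball m x.
  by apply: IH => z /= zs; apply: sub; rewrite /= inE zs orbT.
have [n xn] : conn setT x y by apply: sub; rewrite /= mem_head.
exists (m + n) => z; rewrite /= inE => /orP[/eqP->|/sm].
  exact: (reach_leq (leq_addl _ _) xn).
exact: (reach_leq (leq_addr _ _)).
Qed.

(** Balls are finite by local finiteness, so being infinite is the same as being
    unbounded. The right-hand side only quantifies over vertices and numbers,
    which is what makes infinity of a component definable. *)
Lemma infinite_setP x F : F `<=` conn setT x ->
  infinite_set F <-> forall m, exists2 y, F y & ~ gball m x y.
Proof.
move=> sub; split=> [inf m|all fin].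
  apply: contrapT => no; apply: inf; apply: sub_finite_set (finite_gball m x).
  by move=> y Fy; apply: contrapT => xy; apply: no; exists y.
have [m sm] := finite_sub_gball fin sub.
by have [y /sm] := all m.
Qed.

End Connectivity.

(** * Balls that cut a two-ended graph *)

Section TwoEnded.
Variables (X : choiceType) (G : set (X * X)).
Hypothesis Gsym : forall x y, G (x, y) -> G (y, x).
Hypothesis Gfin : locally_finite G.
Implicit Types (W F S A : set X) (x y z : X).
Local Notation conn := (conn G).
Local Notation gball := (gball G).
Local Hint Resolve conn_refl : core.

Definition nbr A : set X := [set y | exists2 x, A x & G (x, y)].

Definition thick r A : set X := [set y | exists2 x, A x & gball r x y].

Definition inf_comp W y := W y /\ infinite_set (conn W y).

Definition splits F x := exists y z,
  [/\ conn setT x y /\ conn setT x z, inf_comp (~` F) y, inf_comp (~` F) z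
    & ~ conn (~` F) y z].

Definition at_most_two_sides F := forall x y z,
  conn setT x y -> conn setT x z ->
  inf_comp (~` F) x -> inf_comp (~` F) y -> inf_comp (~` F) z ->
  [\/ conn (~` F) x y, conn (~` F) x z | conn (~` F) y z].

Lemma inf_comp_conn W x y : inf_comp W x -> conn W x y -> inf_comp W y.
Proof.
move=> [Wx inf] xy; split; first exact: conn_in xy.
apply: sub_infinite_set inf => z xz.
exact: conn_trans (conn_sym Gsym xy) xz.
Qed.

(** Enlarging a cut to a ball does not destroy an infinite side: each component
    of the complement of the ball is adjacent to the ball, so there are finitely
    many of them, and one has infinite intersection with the given side. *)
Lemma inf_comp_enlarge F r x y : F `&` conn setT x `<=` gball r x ->
  conn setT x y -> inf_comp (~` F) y ->
  exists2 y', conn (~` F) y y' & inf_comp (~` gball r x) y'.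
Proof.
move=> sub xy [Fy inf].
set B := gball r x.
have [w winf] : exists w, infinite_set (conn (~` F) y `&` conn (~` B) w).
  apply: contrapT => fin; apply: inf.
  apply: (@sub_finite_set _ _ (B `|` \bigcup_(w in gball r.+1 x)
      (conn (~` F) y `&` conn (~` B) w))).
    move=> v yv; have [|Bv] := pselect (B v); first by left.
    right.
    have vx : conn setT v x.
      by apply: (conn_sym Gsym); apply: conn_trans xy (conn_setT yv).
    have [|w [vw Bw [g Bg wg]]] := conn_exit vx _ Bv.
      exact: reach_refl.
    exists w; last by split=> //; apply: (conn_sym Gsym).
    by right; exists g => //; split=> //; apply: Gsym.
  rewrite finite_setU; split; first exact: finite_gball.
  apply: bigcup_finite; first exact: finite_gball.
  by move=> w _; apply: contrapT => winf; apply: fin; exists w.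
have [y' [[yy' wy'] By']] := infinite_setN0
  (infinite_setD winf (finite_gball Gfin r x)).
exists y' => //; split=> //.
apply: sub_infinite_set winf => v [_ wv].
exact: conn_trans (conn_sym Gsym wy') wv.
Qed.

Lemma splits_gball x F : finite_set F -> splits F x ->
  exists r, splits (gball r x) x.
Proof.
move=> Ffin [y [z [[xy xz] yinf zinf yz]]].
have [r sub] : exists r, F `&` conn setT x `<=` gball r x.
  by apply: finite_sub_gball; [exact: finite_setIl|move=> u []].
exists r.
have [y' yy' y'inf] := inf_comp_enlarge sub xy yinf.
have [z' zz' z'inf] := inf_comp_enlarge sub xz zinf.
have xy' : conn setT x y' := conn_trans xy (conn_setT yy').
exists y', z'; split=> //.
  by split=> //; apply: conn_trans xz (conn_setT zz').
move=> y'z'; apply: yz.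
apply: conn_trans yy' _; apply: conn_trans (conn_sym Gsym zz').
apply: conn_sub y'z' => v y'v Bv Fv; apply: Bv; apply: sub.
by split=> //; apply: conn_trans xy' (conn_setT y'v).
Qed.

(** From here on, [D] consists of centers of balls that each split their
    component, and these balls are pairwise far apart. The constant
    [2 r + 3 = (r + 1) + 1 + (r + 1)] bounds the distance between the centers
    of two balls of radius [r + 1] that meet or are joined by an edge. *)
Section Cuts.
Variables (D : set X) (r : nat).
Hypothesis G2 : forall F, finite_set F -> at_most_two_sides F.
Hypothesis Dsplits : forall x, D x -> splits (gball r x) x.
Hypothesis Dsep : forall x y, D x -> D y -> gball (r.*2 + 3) x y -> x = y.

Let A := thick r D.

(** A walk that stays within distance one of the balls cannot jump from one ball
    to another, so it remains in a ball of radius [r + 1]. *)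
Lemma finite_conn_thick y : A y \/ nbr A y -> finite_set (conn (A `|` nbr A) y).
Proof.
have ball1 z : A z \/ nbr A z -> exists2 x, D x & gball r.+1 x z.
  move=> [[x Dx xz]|[u [x Dx xu] uz]]; exists x => //.
    exact: reach_leq xz.
  by right; exists u.
move=> /ball1[x Dx xy]; apply: sub_finite_set (finite_gball Gfin r.+1 x).
move=> z yz; apply: (@conn_closed _ _ _ (gball r.+1 x) y z _ yz) => //.
move=> u v uv _ /ball1[x' Dx' x'v] _ xu; suff -> : x = x' by [].
apply: Dsep => //.
apply: (@reach_leq _ _ _ (r.+1 + 1 + r.+1)); first lia.
apply: reach_trans (reach_sym Gsym x'v); apply: reach_trans xu _.
by right; exists u.
Qed.

Definition touches y x := D x /\
  exists u v, [/\ conn (~` A) y u, gball r x v & G (u, v)].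

Lemma gball_disj x x' y : D x -> D x' -> gball r x y -> gball r x' y -> x = x'.
Proof.
move=> Dx Dx' xy x'y; apply: Dsep => //.
apply: (@reach_leq _ _ _ (r + r)); first lia.
by apply: reach_trans xy _; apply: reach_sym.
Qed.

Lemma gball_conn_avoid x x' y z : D x -> D x' -> x <> x' -> gball r x y ->
  gball r x z -> conn (~` gball r x') y z.
Proof.
move=> Dx Dx' xx' xy xz.
have sub : gball r x `<=` ~` gball r x'.
  by move=> w xw x'w; apply: xx'; apply: gball_disj xw x'w.
apply: (@conn_trans _ _ _ _ x).
  by apply: (conn_sym Gsym); apply: conn_mono sub _ (gball_conn xy).
exact: conn_mono sub _ (gball_conn xz).
Qed.

(** Among the two infinite sides of the ball around [x], one does not contain
    [y]. When [y] is connected to another center [x'] off the ball of [x], the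
    ball of [x'] lies on the side of [y], so removing it as well leaves the far
    side intact. The far side remains attached to [x] off the ball of [x']. *)
Lemma far_side x x' y : D x -> D x' -> x <> x' -> conn setT x y ->
  conn (~` gball r x) y x' ->
  exists p, [/\ inf_comp (~` (gball r x `|` gball r x')) p,
    ~ conn (~` gball r x) y p, conn setT x p & conn (~` gball r x') x p].
Proof.
move=> Dx Dx' xx' xy yx'.
have [p [xp pinf yp]] : exists p,
    [/\ conn setT x p, inf_comp (~` gball r x) p & ~ conn (~` gball r x) y p].
  have [p [q [[xp xq] pinf qinf pq]]] := Dsplits Dx.
  have [yp|] := pselect (conn (~` gball r x) y p); last by exists p.
  exists q; split=> // yq; apply: pq.
  by apply: conn_trans yq; apply: (conn_sym Gsym).
have avoid v : conn (~` gball r x) p v -> ~ gball r x' v.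
  move=> pv x'v; apply: yp.
  apply: conn_trans yx' _; apply: (conn_sym Gsym); apply: conn_trans pv _.
  by apply: gball_conn_avoid x'v _ => //; [exact: nesym|exact: reach_refl].
have sub : conn (~` gball r x) p `<=` conn (~` (gball r x `|` gball r x')) p.
  by apply: conn_sub => v pv xv [//|]; apply: avoid.
exists p; split=> //.
  split; last exact: sub_infinite_set sub pinf.2.
  by move=> [|]; [exact: pinf.1|exact: avoid].
have [|w [pw wx [g xg wg]]] := conn_exit (conn_sym Gsym xp) _ pinf.1.
  exact: reach_refl.
have pw' : conn (~` gball r x') p w by apply: conn_sub pw => v /avoid.
have gx : conn (~` gball r x') g x.
  by apply: gball_conn_avoid xg _ => //; exact: reach_refl.
apply: (conn_sym Gsym); apply: conn_trans pw' (conn_trans _ gx).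
apply: conn_edge => //; first exact: avoid.
by move=> x'g; apply: xx'; apply: gball_disj xg x'g.
Qed.

Lemma conn_avoid x y z : D x -> conn (~` A) y z -> conn (~` gball r x) y z.
Proof. by move=> Dx; apply: conn_mono => v Av xv; apply: Av; exists x. Qed.

Lemma touches_conn x x' y : D x' -> x <> x' -> ~ A y -> touches y x ->
  conn (~` gball r x') y x.
Proof.
move=> Dx' xx' Ay [Dx [u [v [yu xv uv]]]].
apply: conn_trans (conn_avoid Dx' yu) _.
apply: (@conn_trans _ _ _ _ v).
  apply: conn_edge => //.
    by move=> x'u; apply: (@conn_in _ _ (~` A) _ _ Ay yu); exists x'.
  by move=> x'v; apply: xx'; apply: gball_disj xv x'v.
by apply: gball_conn_avoid xv _ => //; exact: reach_refl.
Qed.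

(** If an infinite piece touched two of the balls, removing these two balls would
    leave three infinite components: that piece and the two far sides. *)
Lemma inf_comp_touches_one y x x' :
  inf_comp (~` A) y -> touches y x -> touches y x' -> x = x'.
Proof.
move=> [Ay yinf] xt x't; apply: contrapT => xx'.
have [Dx Dx'] := (xt.1, x't.1).
have yx' := touches_conn Dx (nesym xx') Ay x't.
have yx := touches_conn Dx' xx' Ay xt.
have xy := conn_sym Gsym (conn_setT yx).
have x'y := conn_sym Gsym (conn_setT yx').
have [p [pinf yp xp xp']] := far_side Dx Dx' xx' xy yx'.
have [q [qinf yq xq xq']] := far_side Dx' Dx (nesym xx') x'y yx.
rewrite setUC in qinf.
have yinf' : inf_comp (~` (gball r x `|` gball r x')) y.
  split; first by move=> [xv|xv]; apply: Ay; [exists x|exists x'].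
  apply: sub_infinite_set yinf; apply: conn_mono => v Av.
  by move=> [xv|xv]; apply: Av; [exists x|exists x'].
have Ffin : finite_set (gball r x `|` gball r x').
  by rewrite finite_setU; split; exact: finite_gball.
have monox := @conn_mono _ G (~` (gball r x `|` gball r x')) (~` gball r x).
have monox' := @conn_mono _ G (~` (gball r x `|` gball r x')) (~` gball r x').
have yp2 : conn setT y p := conn_trans (conn_setT yx) xp.
have yq2 : conn setT y q := conn_trans (conn_setT yx') xq.
have [c|c|c] := G2 Ffin yp2 yq2 yinf' pinf qinf.
- by apply: yp; apply: monox c => v; apply: contra_not; left.
- by apply: yq; apply: monox' c => v; apply: contra_not; right.
- apply: yq; apply: conn_trans yx _; apply: conn_trans xp' _.
  by apply: monox' c => v; apply: contra_not; right.
Qed.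

(** An infinite piece that touches only the ball of [x] is still a component
    after all but finitely many balls, including that of [x], are put back.
    Hence three infinite pieces touching distinct balls would give three infinite
    components of the complement of a finite set. *)
Lemma touches_three x1 x2 x3 y1 y2 y3 :
  touches y1 x1 -> touches y2 x2 -> touches y3 x3 ->
  inf_comp (~` A) y1 -> inf_comp (~` A) y2 -> inf_comp (~` A) y3 ->
  conn setT y1 y2 -> conn setT y1 y3 ->
  [\/ x1 = x2, x1 = x3 | x2 = x3].
Proof.
move=> t1 t2 t3 i1 i2 i3 c12 c13.
set F := gball r x1 `|` (gball r x2 `|` gball r x3).
have Ffin : finite_set F.
  by rewrite !finite_setU; do !split; exact: finite_gball.
have AF : ~` A `<=` ~` F.
  move=> v Av [xv|[xv|xv]]; apply: Av.
  - by exists x1 => //; exact: t1.1.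
  - by exists x2 => //; exact: t2.1.
  - by exists x3 => //; exact: t3.1.
have shrink x y : touches y x -> inf_comp (~` A) y -> gball r x `<=` F ->
    conn (~` F) y `<=` conn (~` A) y.
  move=> t i xF z yz.
  suff [] : conn (~` A) y z /\ ~ A z by [].
  apply: (@conn_closed _ _ _ [set z | conn (~` A) y z /\ ~ A z] y z _ yz) => //.
    move=> u v uv Fu Fv _ [yu Au].
    have Av : ~ A v.
      move=> [x' Dx' x'v]; apply: Fv; apply: xF.
      suff -> : x = x' by [].
      by apply: inf_comp_touches_one i t _; split=> //; exists u, v.
    by split=> //; apply: conn_trans yu (conn_edge uv _ _).
  by split=> //; exact: i.1.
have inf y : inf_comp (~` A) y -> inf_comp (~` F) y.
  move=> [Ay yi]; split; first exact: AF.
  exact: sub_infinite_set (conn_mono AF) yi.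
have same x y x' y' : touches y x -> touches y' x' -> inf_comp (~` A) y ->
    gball r x `<=` F -> conn (~` F) y y' -> x = x'.
  move=> t [Dx' [u [v [yu xv uv]]]] i xF /(shrink _ _ t i xF) yy'.
  apply: inf_comp_touches_one i t _; split=> //; exists u, v; split=> //.
  exact: conn_trans yy' yu.
have [c|c|c] := G2 Ffin c12 c13 (inf _ i1) (inf _ i2) (inf _ i3).
- by apply: Or31; apply: same t1 t2 i1 _ c; left.
- by apply: Or32; apply: same t1 t3 i1 _ c; left.
- by apply: Or33; apply: same t2 t3 i2 _ c; right; left.
Qed.

(** The part of the balls adjacent to an infinite piece. It picks out a finite
    subset of each component, and it is nonempty exactly where the balls fail to
    leave finite pieces. *)
Definition frontier : set X := A `&` nbr (inf_comp (~` A)).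

Lemma frontier_touches z : frontier z ->
  exists x y, [/\ touches y x, inf_comp (~` A) y, G (y, z) & gball r x z].
Proof.
move=> [[x Dx xz] [y yi yz]]; exists x, y; split=> //.
by split=> //; exists y, z.
Qed.

Lemma finite_frontier x : finite_set (frontier `&` conn setT x).
Proof.
pose E := [set w | exists y,
  [/\ touches y w, inf_comp (~` A) y & conn setT x y]].
apply: (@sub_finite_set _ _ (\bigcup_(w in E) gball r w)).
  move=> z [/frontier_touches[w [y [t i yz wz]]] xz]; exists w => //.
  exists y; split=> //; apply: conn_trans xz _.
  by apply: conn_edge => //; apply: Gsym.
apply: bigcup_finite; last by move=> w _; exact: finite_gball.
have [[a Ea]|no] := pselect (E !=set0); last first.
  by apply: (@sub_finite_set _ _ set0) => // w Ew; apply: no; exists w.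
have [[b [Eb ab]]|no] := pselect (exists b, E b /\ a <> b); last first.
  apply: (@sub_finite_set _ _ [set a]); last exact: finite_set1.
  by move=> w Ew; apply: contrapT => wa; apply: no; exists w; split=> // /esym.
apply: (@sub_finite_set _ _ [set a; b]); last exact: finite_set2.
move=> w [y [t i xy]].
have [ya [ta ia xya]] := Ea.
have [yb [tb ib xyb]] := Eb.
have yab : conn setT ya yb := conn_trans (conn_sym Gsym xya) xyb.
have yaw : conn setT ya y := conn_trans (conn_sym Gsym xya) xy.
by have [//|->|->] := touches_three ta tb t ia ib i yab yaw; [left|right].
Qed.

Lemma frontier_nonempty x y : D x -> conn setT x y -> inf_comp (~` A) y ->
  exists2 z, frontier z & conn setT x z.
Proof.
move=> Dx xy yi.
have Ax : A x by exists x => //; exact: reach_refl.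
have [w [yw Aw [g Ag wg]]] := conn_exit (conn_sym Gsym xy) Ax yi.1.
exists g; last first.
  by apply: conn_trans xy (conn_trans (conn_setT yw) (conn_edge wg _ _)).
by split=> //; exists w => //; apply: inf_comp_conn yw.
Qed.

End Cuts.
End TwoEnded.

(** * Sets that break a graph into finite pieces *)

Section Shattering.
Variables (X : choiceType) (G : set (X * X)).
Hypothesis Gsym : forall x y, G (x, y) -> G (y, x).
Hypothesis Gfin : locally_finite G.
Implicit Types (W F S A : set X) (x y z : X).
Local Notation conn := (conn G).
Local Notation gball := (gball G).
Local Notation nbr := (nbr G).
Local Notation thick := (thick G).

(** Both the complement of [A] and the one-step neighborhood of [A] induce only
    finite components. The neighborhood is included because the coloring of [A]
    has to be proper on the vertices just outside [A] too. *)
Definition shatters A x := forall y, conn setT x y ->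
  finite_set (conn (~` A) y) /\ finite_set (conn (A `|` nbr A) y).

Lemma conn_out W y : ~ W y -> conn W y `<=` [set y].
Proof.
move=> Wy z yz; apply: (@conn_closed _ _ _ [set y] y z _ yz) => // u v _ Wu _ _.
by move=> uy; rewrite uy in Wu.
Qed.

Lemma thick_shatters D r x :
  (forall F, finite_set F -> at_most_two_sides G F) ->
  (forall y, D y -> splits G (gball r y) y) ->
  (forall y z, D y -> D z -> gball (r.*2 + 3) y z -> y = z) ->
  frontier G D r `&` conn setT x = set0 ->
  D `&` conn setT x !=set0 ->
  shatters (thick r D) x.
Proof.
move=> G2 Dsp Dsep fr0 [d [Dd xd]] y xy; split.
- apply: contrapT => inf.
  have [Ay|nAy] := pselect (thick r D y).
    by apply: inf; apply: (sub_finite_set (conn_out _)) (finite_set1 _); apply.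
  have [|z fz dz] := @frontier_nonempty _ _ Gsym D r d y Dd _ (conj nAy inf).
  + by apply: conn_trans xy; apply: (conn_sym Gsym).
  + by rewrite -[False]/(set0 z) -fr0; split=> //; apply: conn_trans dz.
- have [W|nW] := pselect ((thick r D `|` nbr (thick r D)) y).
    exact: finite_conn_thick.
  exact: (sub_finite_set (conn_out _)) (finite_set1 _).
Qed.

(** When a nonempty finite subset [E] of a component is given, the distance from
    [E] cuts the component into finite layers. [layers E] takes every fourth
    distance, so that its complement and its one-step neighborhood both omit one
    residue modulo four, and a walk in either cannot cross an omitted layer. *)
Section Layers.
Variable (E : set X).

Definition level m y := thick m E y /\ forall n, (n < m)%N -> ~ thick n E y.

Definition layers : set X := [set y | exists m, level (4 * m) y].

Lemma level_uniq m n y : level m y -> level n y -> m = n.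
Proof.
move=> [my my'] [ny ny']; case: (ltngtP m n) => // mn.
  by have [] := ny' _ mn.
by have [] := my' _ mn.
Qed.

Lemma level_edge m n u v : G (u, v) -> level m u -> level n v -> (n <= m.+1)%N.
Proof.
move=> uv [[e Ee eu] _] [_ nv]; rewrite leqNgt; apply/negP => /nv; apply.
by exists e => //; right; exists u.
Qed.

Lemma level_ex e y : E e -> conn setT e y -> exists m, level m y.
Proof.
move=> Ee [n ey].
have [|m [my mmin]] := @least_nat (fun m => thick m E y).
  by exists n, e.
by exists m; split=> // k km /mmin; rewrite leqNgt km.
Qed.

Lemma layers_shatters x : finite_set (E `&` conn setT x) ->
  E `&` conn setT x !=set0 -> shatters layers x.
Proof.
move=> fin [e [Ee xe]] y xy.
have lev v : conn setT y v -> exists m, level m v.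
  move=> yv; apply: level_ex Ee _.
  exact: conn_trans (conn_sym Gsym xe) (conn_trans xy yv).
have fint m W : (forall v, conn W y v -> exists2 a, level a v & (a <= m)%N) ->
    finite_set (conn W y).
  move=> sub; apply: (@sub_finite_set _ _
      (\bigcup_(w in E `&` conn setT x) gball m w)).
    move=> v yv; have [a [[w Ew wv] _] am] := sub v yv.
    exists w; last exact: reach_leq am _ wv.
    split=> //; apply: conn_trans xy (conn_trans (conn_setT yv) _).
    by apply: (conn_sym Gsym); exists a.
  by apply: bigcup_finite => // w _; exact: finite_gball.
have [a la] := lev y (conn_refl _ _ _).
split.
- have [|Ly] := pselect (layers y).
    move=> Ly; apply: (sub_finite_set (conn_out _)) (finite_set1 _).
    by apply.
  (* Off [layers] the quotient of the level by four is constant. *)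
  have a0 v b : ~ layers v -> level b v -> (b %% 4 != 0)%N.
    move=> Lv lb; apply/eqP => b0; apply: Lv; exists (b %/ 4).
    by rewrite mulnC -[X in level X](_ : b = _)//; lia.
  apply: (fint (a + 3)) => v yv.
  suff [b lb ba] : exists2 b, level b v & b %/ 4 = a %/ 4.
    by exists b => //; lia.
  apply: (@conn_closed _ _ _ [set v | exists2 b, level b v & b %/ 4 = a %/ 4]
    y v _ yv); last by exists a.
  move=> u w uw Lu Lw yu [b lb ba].
  have [c lc] : exists c, level c w.
    apply: lev; apply: conn_trans (conn_setT yu) _.
    exact: conn_edge uw _ _.
  exists c => //; rewrite -ba.
  have := a0 _ _ Lu lb; have := a0 _ _ Lw lc.
  have := level_edge uw lb lc; have := level_edge (Gsym uw) lc lb.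
  lia.
- have [Ly|Ly] := pselect ((layers `|` nbr layers) y); last first.
    exact: (sub_finite_set (conn_out _)) (finite_set1 _).
  (* Near [layers] the levels are [3], [0], [1] modulo four; shifting by one
     puts these three residues in the same block. *)
  have a2 v b : (layers `|` nbr layers) v -> level b v -> (b %% 4 != 2)%N.
    move=> [[m lm] lb|[u [m lm] uv] lb].
      by rewrite (level_uniq lb lm); lia.
    have := level_edge uv lm lb; have := level_edge (Gsym uv) lb lm.
    lia.
  apply: (fint (a + 3)) => v yv.
  suff [b lb ba] : exists2 b, level b v & b.+1 %/ 4 = a.+1 %/ 4.
    by exists b => //; lia.
  apply: (@conn_closed _ _ _
    [set v | exists2 b, level b v & b.+1 %/ 4 = a.+1 %/ 4]
    y v _ yv); last by exists a.
  move=> u w uw Lu Lw yu [b lb ba].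
  have [c lc] : exists c, level c w.
    apply: lev; apply: conn_trans (conn_setT yu) _.
    exact: conn_edge uw _ _.
  exists c => //; rewrite -ba.
  have := a2 _ _ Lu lb; have := a2 _ _ Lw lc.
  have := level_edge uw lb lc; have := level_edge (Gsym uw) lc lb.
  lia.
Qed.

End Layers.
End Shattering.

(** * Definability in a sigma-algebra *)

Section SetAlgebra.
Variables (X : Type) (S : set (set X)).
Hypothesis S0 : S set0.
Hypothesis SC : forall A, S A -> S (~` A).
Hypothesis SU : forall F : nat -> set X,
  (forall n, S (F n)) -> S (\bigcup_n F n).

Lemma sigma_ex (I : countType) (P : I -> X -> Prop) :
  (forall i, S [set x | P i x]) -> S [set x | exists i, P i x].
Proof.
move=> SP.
pose F n := if unpickle n is Some i then [set x | P i x] else set0.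
have -> : [set x | exists i, P i x] = \bigcup_n F n.
  apply/seteqP; split=> [x [i Pix]|x [n _]].
    by exists (pickle i) => //; rewrite /F pickleK.
  by rewrite /F; case: (unpickle n) => // i Pix; exists i.
by apply: SU => n; rewrite /F; case: (unpickle n).
Qed.

Lemma sigma_not (P : X -> Prop) : S [set x | P x] -> S [set x | ~ P x].
Proof. exact: SC. Qed.

Lemma sigma_all (I : countType) (P : I -> X -> Prop) :
  (forall i, S [set x | P i x]) -> S [set x | forall i, P i x].
Proof.
move=> SP.
have -> : [set x | forall i, P i x] = [set x | ~ exists i, ~ P i x].
  apply/seteqP; split=> [x Px [i]|x no i]; first by apply; exact: Px.
  by apply: contrapT => Pi; apply: no; exists i.
by apply/sigma_not/sigma_ex => i; apply: sigma_not.
Qed.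

Lemma sigma_and (P Q : X -> Prop) :
  S [set x | P x] -> S [set x | Q x] -> S [set x | P x /\ Q x].
Proof.
move=> SP SQ.
have -> : [set x | P x /\ Q x] =
    [set x | forall b, (fun b : bool => if b then P else Q) b x].
  apply/seteqP; split=> [x [Px Qx] []//|x PQ].
  by split; [exact: (PQ true)|exact: (PQ false)].
by apply: sigma_all => -[].
Qed.

Lemma sigma_or (P Q : X -> Prop) :
  S [set x | P x] -> S [set x | Q x] -> S [set x | P x \/ Q x].
Proof.
move=> SP SQ.
have -> : [set x | P x \/ Q x] =
    [set x | exists b, (fun b : bool => if b then P else Q) b x].
  apply/seteqP; split=> [x [Px|Qx]|x [[]]]; by
    [exists true|exists false|left|right].
by apply: sigma_ex => -[].
Qed.

Lemma sigma_imp (P Q : X -> Prop) :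
  S [set x | P x] -> S [set x | Q x] -> S [set x | P x -> Q x].
Proof.
move=> SP SQ.
have -> : [set x | P x -> Q x] = [set x | ~ P x \/ Q x].
  apply/seteqP; split=> [x PQ|x [nP /nP//|Qx _ //]].
  by have [/PQ|] := pselect (P x); [right|left].
by apply: sigma_or => //; apply: sigma_not.
Qed.

Lemma sigma_cst (P : Prop) : S [set x | P].
Proof.
have [p|np] := pselect P.
  have -> : [set x : X | P] = ~` set0.
    by apply/seteqP; split=> [x _ []|x _ //].
  exact: SC.
by have -> : [set x : X | P] = set0 by apply/seteqP; split=> x.
Qed.

Lemma sigma_ext (P Q : X -> Prop) : (forall x, P x <-> Q x) ->
  S [set x | Q x] -> S [set x | P x].
Proof.
by move=> PQ; rewrite (_ : [set x | Q x] = [set x | P x])//;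
  apply/seteqP; split=> x /= /PQ.
Qed.

(** A definable selection that depends only on which of the [P j] hold: choices
    made through it are automatically constant on components whenever the
    conditions are. *)
Lemma first_index (P : nat -> X -> Prop) :
  (forall j, S [set x | P j x]) -> (forall x, exists j, P j x) ->
  exists J : X -> nat, [/\ forall j, S [set x | J x = j],
    forall x, P (J x) x &
    forall x y, (forall j, P j x <-> P j y) -> J x = J y].
Proof.
move=> SP Pex.
pose first x j := P j x /\ forall i, (i < j)%N -> ~ P i x.
have uniq x i j : first x i -> first x j -> i = j.
  move=> [Pi Pi'] [Pj Pj']; case: (ltngtP i j) => // ij.
    by have := Pj' _ ij.
  by have := Pi' _ ij.
have ex x : exists j, first x j.
  have [j [Pj jmin]] := least_nat (Pex x); exists j; split=> // i ij /jmin.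
  by rewrite leqNgt ij.
pose J x := projT1 (cid (ex x)).
have JP x : first x (J x) by rewrite /J; case: cid.
exists J; split=> [j|x|x y xy].
- apply: (@sigma_ext _ (first ^~ j)).
    by move=> x; split=> [<-|]; [exact: JP|exact: uniq].
  apply: sigma_and => //; apply: sigma_all => i.
  by apply: sigma_imp; [exact: sigma_cst|exact: sigma_not].
- by have [] := JP x.
- apply: (uniq x) => //; have [Py Py'] := JP y; split; first exact/xy.
  by move=> i /Py' nP /xy.
Qed.

End SetAlgebra.

(** The sigma-algebra [S] is only assumed to contain a countable family [U] that
    isolates points in finite sets and to be closed under taking neighbors. From
    this the vertices of the component of [x] can be listed as [walk s x], for
    [s] in a countable set, so that quantifiers over a component become countable
    unions and intersections. *)
Section Definable.
Variables (X : choiceType) (G : set (X * X)).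
Hypothesis Gsym : forall x y, G (x, y) -> G (y, x).
Hypothesis Girr : forall x, ~ G (x, x).
Hypothesis Gfin : locally_finite G.
Variables (S : set (set X)) (U : nat -> set X).
Hypothesis S0 : S set0.
Hypothesis SC : forall A, S A -> S (~` A).
Hypothesis SU : forall F : nat -> set X,
  (forall n, S (F n)) -> S (\bigcup_n F n).
Hypothesis Sbase : forall n, S (U n).
Hypothesis Uiso : forall (F : set X) x, finite_set F ->
  exists n, U n x /\ forall y, F y -> U n y -> y = x.
Hypothesis Snbr : forall A, S A -> S (nbr G A).
Implicit Types (W F A : set X) (x y z : X).
Local Notation conn := (conn G).
Local Notation gball := (gball G).
Local Notation nbr := (nbr G).
Local Notation thick := (thick G).
Let Sex := sigma_ex S0 SU.
Let Snot := sigma_not SC.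
Let Sall := sigma_all S0 SC SU.
Let Sand := sigma_and S0 SC SU.
Let Sor := sigma_or S0 SU.
Let Simp := sigma_imp S0 SC SU.
Let Scst := sigma_cst S0 SC.

Definition only_nbr n x y := [/\ G (x, y), U n y &
  forall z, G (x, z) -> U n z -> z = y].

(** Moves to the neighbor in [U n] if there is exactly one, and stays put
    otherwise, so as to be a total function. Every neighbor is reached in this
    way for some [n], since [U] isolates it from the other neighbors. *)
Definition step n x : X :=
  if pselect (exists y, only_nbr n x y) is left ex then projT1 (cid ex) else x.

Lemma stepP n x : only_nbr n x (step n x) \/
  (~ exists y, only_nbr n x y) /\ step n x = x.
Proof.
rewrite /step; case: pselect => [ex|]; last by right.
by left; case: cid.
Qed.

Lemma stepE n x y : only_nbr n x y -> step n x = y.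
Proof.
move=> xy; have [[xs Us _]|[no _]] := stepP n x; last by case: no; exists y.
by case: xy => _ _; apply.
Qed.

Lemma edge_step x y : G (x, y) <-> y <> x /\ exists n, step n x = y.
Proof.
split=> [xy|[yx [n xy]]].
  split; first by move=> yx; apply: (@Girr x); rewrite -{2}yx.
  have [n [Uy iso]] := Uiso y (Gfin x).
  by exists n; apply: stepE; split=> // z xz; apply: iso.
have [[]|[_ sx]] := stepP n x; first by rewrite xy.
by rewrite -xy sx in yx.
Qed.

(** Uniqueness of the neighbor in [U n] is definable because two distinct
    neighbors are separated by some [U a]. *)
Lemma step_in_sigma n A : S A -> S [set x | A (step n x)].
Proof.
move=> SA.
have Snb B : S B -> S [set x | exists y, [/\ B y, U n y & G (x, y)]].
  move=> SB; have := Snbr (Sand SB (Sbase n)); apply: sigma_ext => x.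
  split=> [[y [By Uy xy]]|[y [By Uy] yx]]; exists y => //.
    exact: Gsym.
  by split=> //; apply: Gsym.
have Suniq : S [set x | exists y, only_nbr n x y].
  apply: (@sigma_ext _ _ _ (fun x => (exists y, [/\ True, U n y & G (x, y)]) /\
    ~ exists a, (exists y, [/\ U a y, U n y & G (x, y)]) /\
                (exists y, [/\ ~ U a y, U n y & G (x, y)]))).
    move=> x; split=> [[y [xy Uy yP]]|[[y [_ Uy xy]] no]].
      split; first by exists y.
      move=> [a [[u [au nu xu]] [v [av nv xv]]]]; apply: av.
      by rewrite (yP _ xv nv) -(yP _ xu nu).
    exists y; split=> // z xz Uz; apply: contrapT => zy; apply: no.
    have [a [ay iso]] := Uiso y (finite_set1 z).
    by exists a; split; [exists y|exists z; split=> // az; apply/zy/iso].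
  apply: Sand; first by apply: Snb; apply: Scst.
  apply: Snot; apply: Sex => a; apply: Sand; apply: Snb => //.
  exact: SC (Sbase a).
apply: (@sigma_ext _ _ _ (fun x =>
    (exists y, only_nbr n x y) /\ (exists y, [/\ A y, U n y & G (x, y)]) \/
    (~ exists y, only_nbr n x y) /\ A x)).
  move=> x /=; have [xs|[no ->]] := stepP n x; last first.
    by split=> [|[[]|[]]//]; right.
  have ex : exists y, only_nbr n x y by exists (step n x).
  case: (xs) => Gs Us uniq.
  split=> [As|[[_ [y [Ay Uy xy]]]|[]//]]; last by rewrite -(uniq y).
  by left; split=> //; exists (step n x).
by apply: Sor; apply: Sand => //; [exact: Snb|exact: Snot].
Qed.

Definition walk s x : X := foldr step x s.

Lemma connT_walk x y : conn setT x y <-> exists s, walk s x = y.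
Proof.
split=> [[m]|[s <-]].
  elim: m y => [|m IH] y /=; first by move=> ->; exists [::].
  move=> [/IH//|[z /IH[s <-] [/edge_step[_ [n <-]] _ _]]].
  by exists (n :: s).
elim: s => [|n s IH] /=; first exact: conn_refl.
apply: conn_trans IH _.
have [[sG _ _]|[_ ->]] := stepP n (walk s x); last exact: conn_refl.
exact: conn_edge.
Qed.

Lemma walk_in_sigma s A : S A -> S [set x | A (walk s x)].
Proof.
elim: s A => [|n s IH] A SA //=.
exact: (IH [set y | A (step n y)] (step_in_sigma n SA)).
Qed.

Lemma eq_in_sigma s t : S [set x | walk s x = walk t x].
Proof.
apply: (@sigma_ext _ _ _ (fun x => forall a, U a (walk t x) -> U a (walk s x))).
  move=> x; split=> [-> //|st].
  have [a [at_ iso]] := Uiso (walk t x) (finite_set1 (walk s x)).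
  by apply: iso => //; apply: st.
by apply: Sall => a; apply: Simp; apply: walk_in_sigma.
Qed.

Lemma edge_in_sigma s t : S [set x | G (walk s x, walk t x)].
Proof.
apply: (@sigma_ext _ _ _ (fun x => walk t x <> walk s x /\
    exists n, walk (n :: s) x = walk t x)).
  by move=> x; apply: edge_step.
by apply: Sand; [apply/Snot/eq_in_sigma|apply: Sex => n; apply: eq_in_sigma].
Qed.

(** The subgraph may depend on the base point [x]; the two instances needed are
    a fixed definable set and the complement of a ball around [x]. *)
Section Region.
Variable W : X -> set X.
Hypothesis SW : forall s, S [set x | W x (walk s x)].

Lemma reach_in_sigma m s t : S [set x | reach G (W x) m (walk s x) (walk t x)].
Proof.
elim: m t => [|m IH] t; first exact: eq_in_sigma.
apply: (@sigma_ext _ _ _ (fun x => reach G (W x) m (walk s x) (walk t x) \/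
  exists u, reach G (W x) m (walk s x) (walk u x) /\
    (G (walk u x, walk t x) /\ (W x (walk u x) /\ W x (walk t x))))).
  move=> x; split=> [[|[z sz [zt Wz Wt]]]|[|[u [su [ut [Wu Wt]]]]]].
  - by left.
  - right; have /connT_walk[u uz] : conn setT x z.
      apply: (@conn_trans _ _ _ _ (walk s x)).
        by apply/connT_walk; exists s.
      by apply: conn_setT; exists m; exact: sz.
    by exists u; rewrite uz.
  - by left.
  - by right; exists (walk u x).
apply: Sor => //; apply: Sex => u; apply: Sand => //.
by apply: Sand; [exact: edge_in_sigma|exact: Sand].
Qed.

Lemma conn_in_sigma s t : S [set x | conn (W x) (walk s x) (walk t x)].
Proof. by apply: Sex => m; apply: reach_in_sigma. Qed.

End Region.

Lemma gball_in_sigma m s t : S [set x | gball m (walk s x) (walk t x)].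
Proof. by apply: (reach_in_sigma (W := fun=> setT)) => u; apply: Scst. Qed.

Lemma infinite_in_sigma (W : X -> set X) s :
  (forall s, S [set x | W x (walk s x)]) ->
  S [set x | infinite_set (conn (W x) (walk s x))].
Proof.
move=> SW.
apply: (@sigma_ext _ _ _ (fun x => forall m, exists t,
  conn (W x) (walk s x) (walk t x) /\ ~ gball m (walk s x) (walk t x))).
  move=> x.
  have sub : conn (W x) (walk s x) `<=` conn setT (walk s x).
    by move=> y; apply: conn_setT.
  split=> [/(infinite_setP Gfin sub) inf m|all].
    have [y sy yb] := inf m.
    have /connT_walk[t ty] : conn setT x y.
      apply: conn_trans (conn_setT sy).
      by apply/connT_walk; exists s.
    by exists t; rewrite ty.
  apply/(infinite_setP Gfin sub) => m; have [t [st stb]] := all m.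
  by exists (walk t x).
apply: Sall => m; apply: Sex => t; apply: Sand; first exact: conn_in_sigma.
exact/Snot/gball_in_sigma.
Qed.

Lemma splits_in_sigma r : S [set x | splits G (gball r x) x].
Proof.
have SW s : S [set x | (~` gball r x) (walk s x)].
  exact/Snot/(gball_in_sigma r [::] s).
apply: (@sigma_ext _ _ _ (fun x => exists s t,
    (((~` gball r x) (walk s x) /\
       infinite_set (conn (~` gball r x) (walk s x))) /\
     ((~` gball r x) (walk t x) /\
       infinite_set (conn (~` gball r x) (walk t x)))) /\
    ~ conn (~` gball r x) (walk s x) (walk t x))).
  move=> x; split=> [[y [z [[xy xz] yi zi yz]]]|[s [t [[si ti] st]]]].
    have /connT_walk[s sy] := xy; have /connT_walk[t tz] := xz.
    by exists s, t; rewrite sy tz.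
  exists (walk s x), (walk t x); split=> //.
  by split; apply/connT_walk; [exists s|exists t].
apply: Sex => s; apply: Sex => t; apply: Sand.
  by apply: Sand; apply: Sand => //; apply: infinite_in_sigma.
by apply: Snot; apply: conn_in_sigma.
Qed.

Lemma thick_in_sigma r A : S A -> S (thick r A).
Proof.
move=> SA; apply: (@sigma_ext _ _ _ (fun x => exists s,
  A (walk s x) /\ gball r x (walk s x))).
  move=> x; split=> [[y Ay yx]|[s [As sx]]].
    have /connT_walk[s sy] : conn setT x y.
      by apply: (conn_sym Gsym); exists r.
    by exists s; rewrite sy; split=> //; apply: reach_sym.
  by exists (walk s x) => //; apply: reach_sym.
apply: Sex => s; apply: Sand; first exact: walk_in_sigma.
exact: (gball_in_sigma r [::] s).
Qed.

Lemma setI_in_sigma A B : S A -> S B -> S (A `&` B).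
Proof. exact: Sand. Qed.

Lemma setU_in_sigma A B : S A -> S B -> S (A `|` B).
Proof. exact: Sor. Qed.

Lemma frontier_in_sigma D r : S D -> S (frontier G D r).
Proof.
move=> SD; have SA := thick_in_sigma r SD.
apply: setI_in_sigma => //; apply: Snbr; apply: Sand; first exact: Snot.
apply: (@infinite_in_sigma (fun=> ~` thick r D) [::]) => s.
exact: (walk_in_sigma s (Snot SA)).
Qed.

Lemma layers_in_sigma E : S E -> S (layers G E).
Proof.
move=> SE; apply: Sex => m; apply: Sand; first exact: thick_in_sigma.
apply: Sall => n; apply: Simp; first exact: Scst.
exact/Snot/thick_in_sigma.
Qed.

Lemma shatters_in_sigma A : S A -> S [set x | shatters G A x].
Proof.
move=> SA.
apply: (@sigma_ext _ _ _ (fun x => forall s,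
    ~ infinite_set (conn (~` A) (walk s x)) /\
    ~ infinite_set (conn (A `|` nbr A) (walk s x)))).
  move=> x; split=> [gA s|gA y /connT_walk[s <-]].
    have [|? ?] := gA (walk s x); first by apply/connT_walk; exists s.
    by split=> /(_ _).
  by have [/contrapT ? /contrapT] := gA s.
apply: Sall => s; apply: Sand; apply: Snot.
  apply: (@infinite_in_sigma (fun=> ~` A)) => t.
  exact: walk_in_sigma (Snot SA).
apply: (@infinite_in_sigma (fun=> A `|` nbr A)) => t.
by apply: walk_in_sigma; apply: setU_in_sigma => //; apply: Snbr.
Qed.

Lemma shatters_conn A x y : conn setT x y -> shatters G A x -> shatters G A y.
Proof. by move=> xy gx z yz; apply: gx; apply: conn_trans yz. Qed.

(** * A definable set that breaks every component *)

Section ShatteringSet.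
Hypothesis Gends : forall x, exists2 F, finite_set F & splits G F x.
Hypothesis G2 : forall F, finite_set F -> at_most_two_sides G F.

(** Centers of splitting balls of radius [r], thinned out by keeping only those
    that are alone in [U n] within distance [2 r + 3]. For each [x] some [n]
    retains [x]. *)
Definition cut_points r n := [set x | [/\ splits G (gball r x) x, U n x &
  forall y, gball (r.*2 + 3) x y -> U n y -> y = x]].

Lemma cut_points_in_sigma r n : S (cut_points r n).
Proof.
apply: (@sigma_ext _ _ _ (fun x => splits G (gball r x) x /\ (U n x /\
    forall s, gball (r.*2 + 3) x (walk s x) -> U n (walk s x) ->
      walk s x = x))).
  move=> x; split=> [[sx Ux xP]|[sx [Ux xP]]].
    by split=> //; split=> // s; apply: xP.
  split=> // y xy; have /connT_walk[s sy] : conn setT x y.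
    by exists (r.*2 + 3).
  by move: xy; rewrite -sy; apply: xP.
apply: Sand; first exact: splits_in_sigma.
apply: Sand; first exact: Sbase.
apply: Sall => s; apply: Simp.
  exact: (gball_in_sigma _ [::] s).
apply: Simp.
  exact: (walk_in_sigma s (Sbase n)).
exact: (eq_in_sigma s [::]).
Qed.

Definition candidate (i : bool * (nat * nat)) :=
  let D := cut_points i.2.1 i.2.2 in
  if i.1 then thick i.2.1 D else layers G (frontier G D i.2.1).

Lemma candidate_in_sigma i : S (candidate i).
Proof.
case: i => -[] [r n]; rewrite /candidate /=.
  exact: (thick_in_sigma _ (cut_points_in_sigma r n)).
apply: (layers_in_sigma).
exact: (frontier_in_sigma _ (cut_points_in_sigma r n)).
Qed.

(** If no infinite piece remains outside the balls, the union of the balls breaks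
    the component. Otherwise the frontier is finite and nonempty there, and the
    layers around it do. *)
Lemma candidate_shatters x : exists i, shatters G (candidate i) x.
Proof.
have [F Ffin Fx] := Gends x.
have [r rx] := splits_gball Gsym Gfin Ffin Fx.
have [n [Ux xP]] := Uiso x (finite_gball Gfin (r.*2 + 3) x).
pose D := cut_points r n.
have Dx : D x by [].
have Dsplits y : D y -> splits G (gball r y) y by case.
have Dsep y z : D y -> D z -> gball (r.*2 + 3) y z -> y = z.
  by move=> [_ Uy yP] [_ Uz _] yz; rewrite (yP z).
have [[z [fz xz]]|none] := pselect (frontier G D r `&` conn setT x !=set0).
  exists (false, (r, n)); apply: layers_shatters => //; last by exists z.
  exact: finite_frontier.
exists (true, (r, n)); apply: thick_shatters => //.
  by apply/seteqP; split=> // z fz; apply: none; exists z.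
by exists x; split=> //; exact: conn_refl.
Qed.

(** The candidates are countably many and whether one of them breaks a component
    is definable, so the first successful one can be used on each component. *)
Lemma shattering_set_ex : exists2 A, S A & forall x, shatters G A x.
Proof.
pose P j x := exists i, unpickle j = Some i /\ shatters G (candidate i) x.
have SP j : S [set x | P j x].
  apply: Sex => i; apply: Sand; first exact: Scst.
  exact: (shatters_in_sigma (candidate_in_sigma i)).
have [|J [SJ JP Jeq]] := first_index S0 SC SU SP.
  move=> x; have [i ix] := candidate_shatters x.
  by exists (pickle i), i; rewrite pickleK.
have Jconn x y : conn setT x y -> J x = J y.
  move=> xy; apply: Jeq => j.
  split=> -[i [ji gi]]; exists i; split=> //; first exact: shatters_conn gi.
  exact: shatters_conn (conn_sym Gsym xy) gi.
exists [set x | exists i, unpickle (J x) = Some i /\ candidate i x].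
  apply: (@sigma_ext _ _ _ (fun x => exists j, J x = j /\
      exists i, unpickle j = Some i /\ candidate i x)).
    move=> x; split=> [[i ix]|[j [<-]]//].
    by exists (J x); split=> //; exists i.
  apply: Sex => j; apply: Sand => //; apply: Sex => i.
  by apply: Sand; [exact: Scst|exact: candidate_in_sigma].
move=> x y xy; have [i [Ji gi]] := JP x.
set A := [set x | _].
have AE z : conn setT y z -> A z <-> candidate i z.
  move=> yz; rewrite /A /= -(Jconn _ _ (conn_trans xy yz)) Ji.
  by split=> [[_ [[<-]]]|] //; exists i.
have [fin1 fin2] := gi y xy; split.
  apply: sub_finite_set fin1; apply: conn_sub => z yz; apply: contra_not.
  by move=> /AE; apply; apply: conn_setT yz.
apply: sub_finite_set fin2; apply: conn_sub => z yz.
have yzT := conn_setT yz.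
move=> [/(AE _ yzT)|[u Au uz]]; first by left.
right; exists u => //; apply/AE => //; apply: conn_trans yzT _.
by apply: conn_edge => //; apply: Gsym.
Qed.

End ShatteringSet.

(** * From a breaking set to a coloring *)

Section Coloring.
Variables (k : nat) (c0 : X -> nat).
Hypothesis c0k : forall x, (c0 x < k)%N.
Hypothesis c0col : coloring G c0.

(** Countably many definable functions among which every function on a finite
    set occurs: [pattern l] takes the value prescribed by the first entry of [l]
    whose [U n] contains the point. *)
Definition pattern (l : seq (nat * nat)) x : nat :=
  foldr (fun p c => if `[<U p.1 x>] then p.2 else c) 0 l.

Lemma pattern_in_sigma l a : S [set x | pattern l x = a].
Proof.
elim: l => [|[n b] l IH] /=; first exact: Scst.
apply: (@sigma_ext _ _ _
  (fun x => (U n x /\ b = a) \/ (~ U n x /\ pattern l x = a))).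
  by move=> x; case: asboolP => Ux; split=> [|[] []]//; [left|right].
apply: Sor; apply: Sand.
- exact: Sbase.
- exact: Scst.
- exact/Snot/Sbase.
- exact: IH.
Qed.

Lemma pattern_ex F : finite_set F ->
  exists l, forall x, F x -> pattern l x = c0 x.
Proof.
move=> Ffin; have /finite_seqP[s Fs] := Ffin.
suff H (t : seq X) : {subset t <= s} ->
    exists l, forall x, x \in t -> pattern l x = c0 x.
  by have [l ls] := H s (fun _ => id); exists l => x; rewrite Fs; apply: ls.
elim: t => [|y t IH] ts; first by exists [::].
have [|l lt] := IH; first by move=> z zt; apply: ts; rewrite inE zt orbT.
have [n [Uy yP]] := Uiso y Ffin.
exists ((n, c0 y) :: l) => z /=; rewrite inE.
case: asboolP => Uz zt.
  by rewrite (yP z) // Fs; apply: ts; rewrite inE.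
case/orP: zt => [/eqP zy|]; last exact: lt.
by rewrite zy in Uz.
Qed.

(** On a finite component some [pattern] is a proper coloring; the first one that
    is proper there is used on the whole component. *)
Lemma finite_components_coloring (B : set X) : S B ->
  (forall x, finite_set (conn B x)) ->
  exists c : X -> nat, [/\ forall a, S [set x | c x = a],
    forall x, (c x < k)%N &
    forall x y, B x -> B y -> G (x, y) -> c x <> c y].
Proof.
move=> SB Bfin.
pose proper l x := forall y, conn B x y -> (pattern l y < k)%N /\
  forall z, conn B x z -> G (y, z) -> pattern l y <> pattern l z.
have proper_conn l x y : conn B x y -> proper l x -> proper l y.
  move=> xy px u yu; have [uk up] := px u (conn_trans xy yu); split=> // v yv.
  by apply: up; apply: conn_trans yv.
pose P j x := exists l, unpickle j = Some l /\ proper l x.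
have SW s : S [set x | B (walk s x)].
  exact: (walk_in_sigma s SB).
have Sconn s : S [set x | conn B x (walk s x)].
  exact: (conn_in_sigma (W := fun=> B) SW [::] s).
have Spat s l a : S [set x | pattern l (walk s x) = a].
  exact: (walk_in_sigma s (pattern_in_sigma l a)).
have Sproper l : S [set x | proper l x].
  apply: (@sigma_ext _ _ _ (fun x => forall s, conn B x (walk s x) ->
     ((exists a, pattern l (walk s x) = a /\ (a < k)%N) /\
      forall t, conn B x (walk t x) -> G (walk s x, walk t x) ->
        ~ exists a, pattern l (walk s x) = a /\ pattern l (walk t x) = a))).
    move=> x; split=> [px s xs|px y xy].
      have [sk sp] := px _ xs; split; first by exists (pattern l (walk s x)).
      by move=> t xt st [a [sa ta]]; apply: (sp _ xt st); rewrite sa.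
    have /connT_walk[s sy] := conn_setT xy; rewrite -sy in xy *.
    have [[a [<- sk]] sp] := px s xy; split=> // z xz.
    have /connT_walk[t tz] := conn_setT xz; rewrite -tz in xz *.
    by move=> st e; apply: (sp t xz st); exists (pattern l (walk s x)).
  apply: Sall => s; apply: Simp => //; apply: Sand.
    by apply: Sex => a; apply: Sand => //; exact: Scst.
  apply: Sall => t; apply: Simp => //; apply: Simp.
    exact: (edge_in_sigma).
  by apply: Snot; apply: Sex => a; apply: Sand.
have SP j : S [set x | P j x].
  by apply: Sex => l; apply: Sand => //; exact: Scst.
have [|J [SJ JP Jeq]] := first_index S0 SC SU SP.
  move=> x; have [l lc] := pattern_ex (Bfin x).
  exists (pickle l), l; rewrite pickleK; split=> // y xy.
  by rewrite lc //; split=> // z xz yz; rewrite lc //; apply: c0col.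
pose c x := if unpickle (J x) is Some l then pattern l x else 0.
exists c; split=> [a|x|x y Bx By xy].
- apply: (@sigma_ext _ _ _ (fun x => exists j, J x = j /\
      (if unpickle j is Some l then pattern l x else 0) = a)).
    by move=> x; split=> [ca|[j [<-]]//]; exists (J x).
  apply: Sex => j; apply: Sand => //.
  by case: (unpickle j) => [l|]; [exact: pattern_in_sigma|exact: Scst].
- rewrite /c; have [l [-> px]] := JP x.
  by have [] := px x (conn_refl _ _ _).
- have cxy : conn B x y by exact: conn_edge.
  have Jxy : J x = J y.
    apply: Jeq => j; split=> -[l [jl pl]]; exists l; split=> //.
      exact: proper_conn pl.
    exact: proper_conn (conn_sym Gsym cxy) pl.
  rewrite /c -Jxy; have [l [-> px]] := JP x.
  by have [_] := px x (conn_refl _ _ _); apply.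
Qed.

(** Color [A] together with its neighbors by [c1], and the rest by [c2], each with
    [k] colors. Outside [A], shift [c2] to fresh colors except for its class [0],
    so that the palettes share only the color [0]. A conflict can occur only at a
    vertex of [c2]-class [0] adjacent to a vertex of [A] of [c1]-class [0]; such
    a vertex keeps its [c1]-color, which is not [0], and which outside [A] is
    used by no adjacent vertex since [c2]-class [0] is independent. *)
Lemma shattering_coloring A : S A -> (forall x, shatters G A x) ->
  exists c : X -> nat, [/\ forall a, S [set x | c x = a],
    forall x, (c x < 2 * k - 1)%N & coloring G c].
Proof.
move=> SA gA.
have SnA : S (nbr A) by exact: Snbr.
have [||c1 [S1 k1 col1]] := @finite_components_coloring (A `|` nbr A).
- exact: Sor.
- by move=> x; have [] := gA x x (conn_refl _ _ _).
have [||c2 [S2 k2 col2]] := @finite_components_coloring (~` A).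
- exact: Snot.
- by move=> x; have [] := gA x x (conn_refl _ _ _).
pose N := nbr (A `&` [set x | c1 x = 0]).
have SN : S N by exact: (Snbr (Sand SA (S1 0))).
pose c x := if `[<A x>] then c1 x else
  if c2 x == 0 then (if `[<N x>] then c1 x else 0) else k.-1 + c2 x.
have colA x y : G (x, y) -> A x -> ~ A y -> c x <> c y.
  move=> xy Ax Ay; rewrite /c; case: asboolP => // _; case: asboolP => // _.
  have c1xy : c1 x <> c1 y by apply: col1 => //; [left|right; exists x].
  case: eqP => c2y; last by have := k1 x; lia.
  case: asboolP => // Ny c1x; apply: Ny; exists x => //.
exists c; split=> [a|x|x y xy].
- apply: (@sigma_ext _ _ _ (fun x => (A x /\ c1 x = a) \/ (~ A x /\
      ((c2 x = 0 /\ ((N x /\ c1 x = a) \/ (~ N x /\ 0 = a))) \/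
       exists b, c2 x = b /\ (b <> 0 /\ k.-1 + b = a))))).
    move=> x; rewrite /c; case: asboolP => Ax.
      by split=> [|[[]|[]]//]; left.
    case: eqP => c2x.
      case: asboolP => Nx.
        split=> [|[[]//|[_ [[_ [[]//|[]//]]|[b [bx [b0 _]]]]]]].
          by right; split=> //; left; split=> //; left.
        by rewrite -bx in b0.
      split=> [|[[]//|[_ [[_ [[]//|[]//]]|[b [bx [b0 _]]]]]]].
        by right; split=> //; left; split=> //; right.
      by rewrite -bx in b0.
    split=> [ca|[[]//|[_ [[]//|[b [-> []]//]]]]].
    by right; split=> //; right; exists (c2 x).
  apply: Sor; first exact: Sand SA (S1 a).
  apply: Sand; first exact: Snot.
  apply: Sor; last by apply: Sex => b; apply: Sand (S2 b) (Scst _).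
  apply: Sand (S2 0) (Sor (Sand SN (S1 a)) (Sand _ (Scst _))).
  exact: Snot.
- have := k1 x; have := k2 x; rewrite /c.
  by case: asboolP => _; [|case: eqP => _; [case: asboolP => _|]]; lia.
- have [Ax|Ax] := pselect (A x); have [Ay|Ay] := pselect (A y).
  + rewrite /c; case: asboolP => // _; case: asboolP => // _.
    by apply: col1 => //; left.
  + exact: colA.
  + by move=> /esym; apply: colA => //; apply: Gsym.
  + have := col2 x y Ax Ay xy; have := k1 x; have := k1 y.
    rewrite /c (asboolF Ax) (asboolF Ay).
    case: (c2 x =P 0) => [->|c2x]; case: (c2 y =P 0) => [->|c2y] //.
    * by case: asboolP => _; lia.
    * by case: asboolP => _; lia.
    * lia.
Qed.

End Coloring.

Theorem definable_coloring k (c0 : X -> nat) :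
  (forall x, exists2 F, finite_set F & splits G F x) ->
  (forall F, finite_set F -> at_most_two_sides G F) ->
  (forall x, (c0 x < k)%N) -> coloring G c0 ->
  exists c : X -> nat, [/\ forall a, S [set x | c x = a],
    forall x, (c x < 2 * k - 1)%N & coloring G c].
Proof.
move=> Gends G2 c0k c0col; have [A SA gA] := shattering_set_ex Gends G2.
exact: shattering_coloring c0k c0col _ SA gA.
Qed.

End Definable.

(** * Borel sets *)

Section BorelSets.
Variable T : topologicalType.

Lemma borel0 : borel (@set0 T).
Proof. exact: sigma_algebra0. Qed.

Lemma borelC (A : set T) : borel A -> borel (~` A).
Proof. by move=> bA; rewrite -setTD; apply: sigma_algebraCD. Qed.

Lemma borel_bigcup (F : nat -> set T) :
  (forall n, borel (F n)) -> borel (\bigcup_n F n).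
Proof.
by move=> bF; case: (smallest_sigma_algebra setT (@open T)) => _ _; apply.
Qed.

Lemma borel_open (A : set T) : open A -> borel A.
Proof. exact: sub_sigma_algebra. Qed.

Lemma borel_closed (A : set T) : closed A -> borel A.
Proof.
move=> /closed_openC oA; rewrite -[A]setCK; apply: borelC; exact: borel_open.
Qed.

Lemma borel_ind (P : set (set T)) : (forall A, open A -> P A) -> P set0 ->
  (forall A, P A -> P (~` A)) ->
  (forall F : nat -> set T, (forall n, P (F n)) -> P (\bigcup_n F n)) ->
  @borel T `<=` P.
Proof.
move=> Popen P0 PC PU; apply: smallest_sub => //; split=> // A.
by rewrite setTD; apply: PC.
Qed.

End BorelSets.

Lemma borel_preimage (S T : topologicalType) (f : S -> T) :
  continuous f -> forall B, borel B -> borel (f @^-1` B).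
Proof.
move=> /continuousP fc.
apply: (@borel_ind _ (fun B => borel (f @^-1` B))) => [A /fc|||] /=.
- exact: borel_open.
- by rewrite preimage_set0; apply: borel0.
- by move=> A; rewrite preimage_setC; apply: borelC.
- by move=> F bF; rewrite preimage_bigcup; apply: borel_bigcup.
Qed.

(** * Coding Borel sets by sequences of natural numbers *)

Section Sequences.
Variable T : topologicalType.

Definition tends (u : nat -> T) (b : T) :=
  forall V, nbhs b V -> exists N, forall n, (N <= n)%N -> V (u n).

Definition settles (f : nat -> nat) (v : nat) :=
  exists N, forall n, (N <= n)%N -> f n = v.

Lemma settles_uniq f v w : settles f v -> settles f w -> v = w.
Proof.
move=> [N Nv] [M Mw].
by rewrite -(Nv (maxn N M)) ?leq_maxl // (Mw (maxn N M)) // leq_maxr.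
Qed.

Lemma tends_uniq u a b : hausdorff_space T -> tends u a -> tends u b -> a = b.
Proof.
move=> hT ua ub; apply: hT => V W /ua[N NV] /ub[M MW].
exists (u (maxn N M)); split; first by apply: NV; rewrite leq_maxl.
by apply: MW; rewrite leq_maxr.
Qed.

Lemma tends_sub u b (f : nat -> nat) :
  (forall n, (n <= f n)%N) -> tends u b -> tends (u \o f) b.
Proof.
move=> nf ub V /ub[N NV]; exists N => n Nn; apply: NV.
exact: leq_trans Nn (nf n).
Qed.

Lemma tends_tail u b N : tends (fun n => u (n + N)) b -> tends u b.
Proof.
move=> ub V /ub[M MV]; exists (M + N) => n MNn.
rewrite -(@subnK N n); last exact: leq_trans (leq_addl _ _) MNn.
by apply: MV; lia.
Qed.

Lemma tends_in (C : set T) u b :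
  (exists N, forall n, (N <= n)%N -> C (u n)) -> closed C -> tends u b -> C b.
Proof.
move=> [N NC] clC ub; apply: clC => V /ub[M MV].
exists (u (maxn N M)); split; first by apply: NC; rewrite leq_maxl.
by apply: MV; rewrite leq_maxr.
Qed.

(** [phi] plays the part of the inverse of a continuous map from a set of
    sequences of numbers onto [B]: if all coordinates of a sequence in [B] are
    eventually constant, then the sequence converges in [B]. The coordinates of
    the limit are only required to be at least as large as the limits of the
    coordinates. This semicontinuity is enough for the separation argument, and
    it holds when a coordinate is the first index of an open set containing the
    point, so that no passage to zero-dimensional spaces is needed. *)
Definition coding (phi : nat -> T -> nat) (B : set T) :=
  forall u z, (forall n, B (u n)) -> (forall i, settles (phi i \o u) (z i)) ->
  exists b, [/\ B b, tends u b & forall i, (z i <= phi i b)%N].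

Definition coded B := exists phi, coding phi B.

Lemma coded_bigcap (F : nat -> set T) : hausdorff_space T ->
  (forall k, coded (F k)) -> coded (\bigcap_k F k).
Proof.
move=> hT /choice[phi phiP].
exists (fun j x => if unpickle j is Some ki then phi ki.1 ki.2 x else 0).
move=> u z uF uz.
have lim k : exists b, [/\ F k b, tends u b &
    forall i, (z (pickle (k, i)) <= phi k i b)%N].
  apply: (phiP k u (fun i => z (pickle (k, i)))) => [n|i]; first exact: uF.
  by have := uz (pickle (k, i)); rewrite /comp pickleK.
have [b [F0b ub _]] := lim 0; exists b; split=> // [k _|j].
  by have [c [Fc uc _]] := lim k; rewrite (tends_uniq hT ub uc).
have := uz j; rewrite /comp; case ej: (unpickle j) => [[k i]|] /= ujz.
  have ji : z j = z (pickle (k, i)).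
    apply: settles_uniq ujz _.
    by have := uz (pickle (k, i)); rewrite /comp pickleK.
  by have [c [_ uc zc]] := lim k; rewrite ji (tends_uniq hT ub uc).
by have [N /(_ N (leqnn _)) <-] := ujz.
Qed.

(** Disjointness makes the index of the piece containing a point equal, at the
    limit, to its eventual value along the sequence. *)
Lemma coded_bigcup (F : nat -> set T) : trivIset setT F ->
  (forall k, coded (F k)) -> coded (\bigcup_k F k).
Proof.
move=> Ftriv /choice[phi phiP].
have /choice[idx idxP] x : exists k, (\bigcup_k F k) x -> F k x.
  by have [[k _ Fx]|] := pselect ((\bigcup_k F k) x); [exists k|exists 0].
exists (fun j x => if j is i.+1 then phi (idx x) i x else idx x).
move=> u z uF uz; have [N uN] := uz 0; set k := z 0 in uN.
have uk n : (N <= n)%N -> F k (u n).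
  by move=> Nn; have := idxP _ (uF n); rewrite [idx _]uN.
have [||b [Fb ub zb]] := phiP k (fun n => u (n + N)) (fun i => z i.+1).
- by move=> n; apply: uk; rewrite leq_addl.
- move=> i; have [M uM] := uz i.+1; exists (M + N) => n Mn.
  have := uM (n + N); rewrite /= [idx _]uN ?leq_addl //; apply.
  by rewrite (leq_trans (leq_addr N M)) // (leq_trans Mn) // leq_addr.
have Ub : (\bigcup_k F k) b by exists k.
have idxb : idx b = k.
  by apply: Ftriv => //; exists b; split=> //; apply: idxP.
by exists b; split=> [//||[|i]]; [exact: tends_tail ub| |]; rewrite ?idxb.
Qed.

Lemma coded_closed (C : set T) : coded setT -> closed C -> coded C.
Proof.
move=> [phi phiP] clC; exists phi => u z uC uz.
have [//|b [_ ub zb]] := phiP u z _ uz; exists b; split=> //.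
by apply: tends_in ub => //; exists 0.
Qed.

End Sequences.

Section MetricCoding.
Context {R : realType} (T : pseudoMetricType R).
Implicit Types U B : set T.
Local Open Scope ring_scope.

(** The extra coordinate is the first [m] such that all points close enough to
    the given one have their ball of radius [1 / (m + 1)] inside [U]. When it is
    eventually constant, the sequence stays away from the complement of [U]. *)
Lemma coded_open U : coded [set: T] -> open U -> coded U.
Proof.
move=> [phi phiP] openU.
pose W m := ([set y | ball y m.+1%:R^-1 `<=` U] : set T)°.
have UW x : U x -> exists m, W m x.
  move=> Ux; have /nbhs_ballP[e /= e0 xU] : nbhs x U by apply: open_nbhs_nbhs.
  have [m _ me] := near_infty_natSinv_lt (PosNum (divr_gt0 e0 (ltr0Sn R 1))).
  exists m; apply/nbhs_ballP; exists (m.+1%:R^-1) => //= y xy z yz.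
  apply: xU; apply: (le_ball _ (ball_triangle xy yz)).
  have := me m (leqnn _); rewrite /= => /ltW me2.
  by rewrite (splitr e) lerD.
have least x : exists m, U x -> W m x /\ forall i, W i x -> (m <= i)%N.
  have [Ux|] := pselect (U x); last by exists 0%N.
  by have [m] := least_nat (UW x Ux); exists m.
have [m mP] := choice least.
exists (fun j => if j is i.+1 then phi i else m) => u z uU uz.
have [//|i|b [_ ub zb]] := phiP u (fun i => z i.+1); first exact: (uz i.+1).
have [N uN] := uz 0%N.
have WN n : (N <= n)%N -> W (z 0%N) (u n).
  by move=> Nn; have [Wu _] := mP _ (uU n); rewrite -(uN n Nn).
have Ub : U b.
  have [|M uM] := ub (ball b (z 0%N).+1%:R^-1).
    by apply: nbhsx_ballx; rewrite invr_gt0.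
  apply: (interior_subset (WN (maxn N M) (leq_maxl _ _))).
  by apply: ball_sym; apply: uM; rewrite leq_maxr.
exists b; split=> // -[|i]; last exact: zb.
rewrite leqNgt; apply/negP => lt.
have : (~` W (m b)) b.
  apply: tends_in ub; last by apply: open_closedC; apply: open_interior.
  exists N => n Nn Wn; have [_ /(_ _ Wn)] := mP _ (uU n).
  by rewrite [m (u n)](uN n Nn) leqNgt lt.
by have [] := mP b Ub.
Qed.

(** The sets that are coded together with their complements form a
    sigma-algebra: a countable union is first made disjoint. *)
Lemma coded_borel : hausdorff_space T -> coded [set: T] ->
  forall B, borel B -> coded B.
Proof.
move=> hT cT B bB; suff [] : coded B /\ coded (~` B) by [].
apply: (@borel_ind _ (fun B => coded B /\ coded (~` B))) B bB.
- move=> A oA; split; first exact: coded_open.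
  by apply: coded_closed => //; apply: open_closedC.
- by rewrite setC0; split=> //; apply: coded_closed => //; apply: closed0.
- by move=> A []; rewrite setCK.
move=> F FP; split.
  have -> : \bigcup_n F n = \bigcup_n
      \bigcap_i (if (i < n)%N then ~` F i else F n).
    apply/seteqP; split=> [x [n _ Fx]|x [n _ Fx]]; last first.
      by exists n => //; have := Fx n I; rewrite ltnn.
    have [|k [Fk kmin]] := @least_nat (fun n => F n x); first by exists n.
    exists k => // i _; case: ifP => // ik Fi.
    by move: ik; rewrite ltnNge => /negP; apply; exact: kmin.
  apply: coded_bigcup.
    apply/trivIsetP => i j _ _; rewrite neq_ltn => ij.
    apply/seteqP; split=> // x.
    case/orP: ij => ij [Fi Fj].
      by have := Fj i I; rewrite ij; have := Fi i I; rewrite ltnn.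
    by have := Fi j I; rewrite ij; have := Fj j I; rewrite ltnn.
  move=> n; apply: coded_bigcap => // i.
  by case: ifP => _; [case: (FP i)|case: (FP n)].
by rewrite setC_bigcup; apply: coded_bigcap => // i; case: (FP i).
Qed.

End MetricCoding.

Lemma small_open_cover (R : realType) (M : metricType R) : Defs.separable M ->
  exists W : nat -> nat -> set M, [/\ forall i j, open (W i j),
    forall i x, exists j, W i j x &
    forall i j x y, W i j x -> W i j y -> ball x i.+1%:R^-1%R y].
Proof.
move=> [D Dc Dd].
have [f finj] : exists f : M -> nat, {in D &, injective f}.
  by move: Dc => /countable_injP[f]; exists f.
have e0 i : (0 < i.+1%:R^-1 / 2 :> R)%R by rewrite divr_gt0 // invr_gt0.
exists (fun i j => [set x |
  exists p, [/\ D p, f p = j & (ball p (i.+1%:R^-1 / 2)%R)° x]]).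
split=> [i j|i x|i j x y [p [Dp pj xp]] [q [Dq qj yq]]].
- rewrite openE => x [p [Dp pj xp]].
  have := open_nbhs_nbhs (conj (@open_interior M _) xp).
  by apply: filterS => y yp; exists p.
- have [|p [xp Dp]] := Dd (ball x (i.+1%:R^-1 / 2 / 2)%R)° _ (open_interior _).
    by exists x; apply: nbhsx_ballx; rewrite divr_gt0.
  exists (f p), p; split=> //.
  apply/nbhs_ballP; exists (i.+1%:R^-1 / 2 / 2)%R => [|y xy] /=.
    by rewrite divr_gt0.
  rewrite (splitr (i.+1%:R^-1 / 2)); apply: ball_triangle xy.
  exact: ball_sym (interior_subset xp).
- have pq : p = q by apply: finj; rewrite ?inE // pj.
  rewrite -pq in yq; rewrite (splitr i.+1%:R^-1).
  apply: (@ball_triangle _ _ p); last exact: interior_subset yq.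
  exact: ball_sym (interior_subset xp).
Qed.

(** The coordinates say which small open sets contain the point, so a sequence
    with eventually constant coordinates is a Cauchy sequence. *)
Lemma coded_complete (R : realType) (M : metricType R) :
  complete_metric M -> Defs.separable M -> coded [set: M].
Proof.
move=> Mc /small_open_cover[W [Wopen Wex Wball]].
have [phi phiP] := choice (fun ix : nat * M => least_nat (Wex ix.1 ix.2)).
exists (fun i x => phi (i, x)) => u z _ uz.
have Wu i : exists N, forall n, (N <= n)%N -> W i (z i) (u n).
  have [N uN] := uz i; exists N => n Nn.
  have [+ _] := phiP (i, u n).
  by rewrite (uN n Nn : phi (i, u n) = z i).
have [|b ub] := Mc (u @ \oo) _.
  apply/cauchyP => e e0.
  have [i _ ie] := near_infty_natSinv_lt (PosNum e0).
  have [N uN] := Wu i.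
  exists (u N), N => //= n Nn.
  apply: (le_ball (ltW (ie i (leqnn _)))).
  exact: Wball (uN N (leqnn _)) (uN n Nn).
have ub' : tends u b by move=> V /ub[N _ NV]; exists N.
exists b; split=> // i; rewrite leqNgt; apply/negP => lt.
have [Wb _] := phiP (i, b).
have : (~` W i (phi (i, b))) b.
  apply: tends_in ub'; last exact: open_closedC.
  have [N uN] := uz i; exists N => n Nn Wn.
  have [_ /(_ _ Wn)] := phiP (i, u n).
  by rewrite /= (uN n Nn : phi (i, _) = _) leqNgt lt.
exact.
Qed.

Lemma coded_prod (S T : topologicalType) :
  coded [set: S] -> coded [set: T] -> coded [set: S * T].
Proof.
move=> [phi phiP] [psi psiP].
exists (fun j x => if odd j then phi j./2 x.1 else psi j./2 x.2).
move=> u z _ uz.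
have [//|i|a [_ ua za]] := phiP (fst \o u) (fun i => z i.*2.+1).
  by have := uz i.*2.+1; rewrite /comp /= odd_double /= uphalf_double.
have [//|i|b [_ ub zb]] := psiP (snd \o u) (fun i => z i.*2).
  by have := uz i.*2; rewrite /comp /= odd_double /= half_double.
exists (a, b); split=> // [V [[A B] /= [aA bB] AB]|j].
  have [N NA] := ua A aA; have [M MB] := ub B bB.
  exists (maxn N M) => n; rewrite geq_max => /andP[Nn Mn]; apply: AB.
  by split; [exact: NA|exact: MB].
rewrite -{1}(odd_double_half j); case: (odd j) => /=; first exact: za.
exact: zb.
Qed.

(** * Finitely branching trees *)

Section Trees.
Implicit Types (s t : seq nat) (Q : seq nat -> Prop).

Lemma branch_ex Q : Q [::] -> (forall s, Q s -> exists k, Q (rcons s k)) ->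
  exists z, forall n, Q (mkseq z n).
Proof.
move=> Q0 Qs.
have /choice[f fP] s : exists k, Q s -> Q (rcons s k).
  by have [/Qs[k Qk]|nQ] := pselect (Q s); [exists k|exists 0].
pose pre := fix pre n := if n is m.+1 then rcons (pre m) (f (pre m)) else [::].
exists (fun n => f (pre n)) => n.
have -> : mkseq (fun n => f (pre n)) n = pre n.
  by elim: n => //= n IH; rewrite mkseqS IH.
by elim: n => //= n /fP.
Qed.

(** Koenig's lemma, with the number of successors at depth [n] bounded by [w n]. *)
Lemma konig Q (w : nat -> nat) :
  (forall s k, Q (rcons s k) -> Q s) ->
  (forall s k, Q (rcons s k) -> (k < w (size s))%N) ->
  (forall n, exists s, size s = n /\ Q s) ->
  exists z, forall n, Q (mkseq z n).
Proof.
move=> Qpre Qw Qinf.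
have Qcat s t : Q (s ++ t) -> Q s.
  elim/last_ind: t => [|t k IH]; first by rewrite cats0.
  by rewrite -rcons_cat => /Qpre.
suff [z zP] : exists z, forall n k, exists t, size t = k /\ Q (mkseq z n ++ t).
  by exists z => n; have [t [_ /Qcat]] := zP n 0.
apply: (@branch_ex (fun s => forall k, exists t, size t = k /\ Q (s ++ t))).
  exact: Qinf.
move=> s sP; apply: contrapT => no.
have /choice[N NP] k : exists n, forall t, size t = n -> ~ Q (rcons s k ++ t).
  apply: contrapT => nok; apply: no; exists k => n.
  apply: contrapT => non; apply: nok; exists n => t tn Qt.
  by apply: non; exists t.
have [[|k t] [//= [tn] Qt]] := sP (\max_(k < w (size s)) N k).+1.
have kw : (k < w (size s))%N.
  by apply: Qw; apply: (Qcat _ t); rewrite cat_rcons.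
have Nt : (N k <= size t)%N.
  rewrite tn.
  exact: (@leq_bigmax _ (fun k : 'I_(w (size s)) => N k) (Ordinal kw)).
apply: (NP k (take (N k) t)); first by rewrite size_takel.
by apply: (Qcat _ (drop (N k) t)); rewrite -catA cat_take_drop cat_rcons.
Qed.

End Trees.

(** * Finite-to-one images of Borel sets are Borel *)

Section Projection.
Context {R : realType} (T : topologicalType) (Y : pseudoMetricType R).
Hypothesis hT : hausdorff_space T.
Hypothesis hY : hausdorff_space Y.
Variable p : T -> Y.
Hypothesis pc : continuous p.
Variables (B : set T) (phi : nat -> T -> nat).
Hypothesis phiB : coding phi B.
Hypothesis fibre : forall y, finite_set (B `&` p @^-1` [set y]).

Let Sex := sigma_ex (@borel0 Y) (@borel_bigcup Y).
Let Snot := sigma_not (@borelC Y).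
Let Sall := sigma_all (@borel0 Y) (@borelC Y) (@borel_bigcup Y).
Let Sand := sigma_and (@borel0 Y) (@borelC Y) (@borel_bigcup Y).
Let Simp := sigma_imp (@borel0 Y) (@borelC Y) (@borel_bigcup Y).
Let Scst := sigma_cst (@borel0 Y) (@borelC Y).

Lemma tends_image u b : tends u b -> tends (p \o u) (p b).
Proof. by move=> ub V /pc/ub. Qed.

Lemma fibre_bound i y : exists m, forall b, B b -> p b = y -> (phi i b < m)%N.
Proof.
have /finite_seqP[s sP] := finite_image (phi i) (fibre y).
exists (\max_(k <- s) k).+1 => b Bb pb; rewrite ltnS.
apply: (@leq_bigmax_seq _ _ xpredT id) => //.
by change ([set` s] (phi i b)); rewrite -sP; exists b.
Qed.

Definition borel_separated (A : nat -> set Y) := exists E : nat -> set Y,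
  [/\ forall m, borel (E m), forall m, A m `<=` E m &
      forall y, exists m, ~ E m y].

(** For a fixed coordinate [i0], the images of the sets where [phi i0 >= m]
    decrease to the empty set as [m] grows, since fibers are finite. They are
    enclosed in Borel sets with empty intersection, by the following argument
    of Mokobodzki for the separation theorem of Novikov. *)
Section Novikov.
Variable i0 : nat.

(** The prefix [s] prescribes, through the pairing of [m] and [i] into one number,
    coordinate [i] of the witness for the [m]-th set, for all [m] at once. *)
Definition pieces s m : set Y := [set y | exists b,
  [/\ B b, p b = y, (m <= phi i0 b)%N & forall t (i : nat), (t < size s)%N ->
    unpickle t = Some (m, i) -> phi i b = nth 0 s t]].

(** If for every prescribed value the refined sequences of sets could be
    enclosed, then so could the original one, by taking the union over the values
    for the index [m0] that is refined and the intersection for the others. *)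
Lemma pieces_step s :
  ~ borel_separated (pieces s) ->
  exists k, ~ borel_separated (pieces (rcons s k)).
Proof.
move=> ns; apply: contrapT => no; apply: ns.
have /choice[E EP] k : borel_separated (pieces (rcons s k)).
  by apply: contrapT => nk; apply: no; exists k.
have sub m k : (forall i : nat, unpickle (size s) <> Some (m, i)) ->
    pieces s m `<=` E k m.
  move=> no_m y [b [Bb pb mb bs]]; have [_ Ek _] := EP k; apply: Ek.
  exists b; split=> // t i; rewrite size_rcons ltnS leq_eqVlt nth_rcons.
  case: eqP => [-> _ e|_ /= ts]; first by case: (no_m i).
  by rewrite ts; apply: bs.
case e: (unpickle (size s) : option (nat * nat)) => [[m0 i]|]; last first.
  have [E0 _ Eempty] := EP 0; exists (E 0); split=> // m.
  by apply: sub => i; rewrite e.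
exists (fun m => [set y | (m = m0 -> exists k, E k m y) /\
                          (m <> m0 -> forall k, E k m y)]).
split=> [m|m y my|y].
- apply: Sand; apply: Simp; try exact: Scst.
    by apply: Sex => k; have [Eb _ _] := EP k; exact: Eb.
  by apply: Sall => k; have [Eb _ _] := EP k; exact: Eb.
- split=> [mm0|mm0 k]; last first.
    by apply: sub my => j; rewrite e => -[] /esym.
  have [b [Bb pb mb bs]] := my; exists (phi i b).
  have [_ Ek _] := EP (phi i b); apply: Ek; exists b; split=> // t j.
  rewrite size_rcons ltnS leq_eqVlt nth_rcons.
  case: eqP => [-> _|_ /= ts]; last by rewrite ts; apply: bs.
  by rewrite e ltnn => -[_ <-].
- apply: contrapT => no_m.
  have all m : (m = m0 -> exists k, E k m y) /\ (m <> m0 -> forall k, E k m y).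
    by apply: contrapT => nm; apply: no_m; exists m.
  have [k Ek] := (all m0).1 erefl.
  have [_ _ /(_ y)[m]] := EP k; apply.
  by have [->//|mm0] := pselect (m = m0); apply: (all m).2.
Qed.

Lemma pieces_sub z t t' m : (t <= t')%N ->
  pieces (mkseq z t') m `<=` pieces (mkseq z t) m.
Proof.
move=> tt' y [b [Bb pb mb bs]]; exists b; split=> // tau i.
rewrite size_mkseq => taut e; have taut' := leq_trans taut tt'.
by rewrite (bs tau i _ e) ?size_mkseq // !nth_mkseq.
Qed.

Section Branch.
Variable z : nat -> nat.
Hypothesis zP : forall t, ~ borel_separated (pieces (mkseq z t)).

(** Along a branch of families that cannot be enclosed, the [m]-th pieces are
    nonempty, and the coding makes them shrink to the image of one point. *)
Lemma pieces_limit m : exists b, [/\ B b, (m <= phi i0 b)%N &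
  forall V, nbhs (p b) V -> exists t, pieces (mkseq z t) m `<=` V].
Proof.
pose near_z t b := [/\ B b, (m <= phi i0 b)%N & forall i,
  (pickle (m, i) < t)%N -> phi i b = z (pickle (m, i))].
have lim u (f : nat -> nat) : (forall n, near_z (f n) (u n)) ->
    (forall N, exists M, forall n, (M <= n)%N -> (N <= f n)%N) ->
    exists b, [/\ B b, tends u b & forall i, (z (pickle (m, i)) <= phi i b)%N].
  move=> uf finf; apply: (phiB (z := fun i => z (pickle (m, i)))).
    by move=> n; have [] := uf n.
  move=> i; have [M Mf] := finf (pickle (m, i)).+1.
  by exists M => n /Mf fn; have [_ _] := uf n; apply.
have piecesP t y : pieces (mkseq z t) m y ->
    exists b, near_z t b /\ p b = y.
  move=> [b [Bb pb mb bs]]; exists b; split=> //; split=> // i it.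
  by rewrite (bs _ i _ (pickleK _)) ?size_mkseq // nth_mkseq.
have /choice[u uP] t : exists b, near_z t b.
  have [[y /piecesP[b []]]|none] := pselect (pieces (mkseq z t) m !=set0).
    by exists b.
  case: (@zP t); exists (fun n => if n == m then set0 else setT); split.
  - by move=> n; case: ifP => _; [exact: borel0|exact: (Scst True)].
  - move=> n y ny; case: eqP => // nm.
    by case: none; exists y; rewrite -nm.
  - by move=> y; exists m; rewrite eqxx.
have [|b [Bb ub zb]] := lim u id uP; first by move=> N; exists N.
exists b; split=> //.
  apply: leq_trans (zb i0).
  by have [_ mu <-] := uP (pickle (m, i0)).+1.
move=> V Vb; apply: contrapT => no.
have /choice[w wP] t : exists b', near_z t b' /\ ~ V (p b').
  apply: contrapT => now; apply: no; exists t => y /piecesP[b' [b't pb']].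
  by apply: contrapT => Vy; apply: now; exists b'; rewrite pb'.
(* Interleaving [u] and [w] forces their limits to be equal. *)
pose v n := if odd n then w n./2 else u n./2.
have [n|N|c [Bc vc _]] := lim v half.
- by rewrite /v; case: ifP => _; [case: (wP n./2)|].
- by exists N.*2 => n Nn; rewrite -(doubleK N); exact: half_leq.
have uc : tends u c.
  have -> : u = v \o double.
    by apply/funext => n; rewrite /v /= odd_double doubleK.
  by apply: tends_sub vc => n; rewrite -addnn leq_addr.
have wc : tends w c.
  have -> : w = v \o (fun n => n.*2.+1).
    by apply/funext => n; rewrite /v /= odd_double uphalf_double.
  by apply: tends_sub vc => n; rewrite -addnn leqW // leq_addr.
rewrite -(tends_uniq hT ub uc) in wc.
have [N NV] := tends_image wc Vb.
by have [_] := wP N; apply; apply: (NV N).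
Qed.

End Branch.

(** Along a branch, two different limit points would be separated by disjoint
    open sets, which enclose the pieces. So all limits agree, which gives a fiber
    on which [phi i0] is unbounded. *)
Lemma pieces_separated : borel_separated (pieces [::]).
Proof.
apply: contrapT => /branch_ex /(_ pieces_step)[z zP].
have /choice[b bP] := pieces_limit zP.
have [[m neq]|same] := pselect (exists m, p (b m) != p (b 0)).
  move: hY; rewrite open_hausdorff => /(_ _ _ neq)[[U V] /=].
  move=> [/set_mem Um /set_mem V0] [oU oV /eqP UV].
  have [_ _ /(_ U)[|t tU]] := bP m; first exact: open_nbhs_nbhs.
  have [_ _ /(_ V)[|t' tV]] := bP 0; first exact: open_nbhs_nbhs.
  apply: (zP (maxn t t')).
  exists (fun n => if n == 0 then V else if n == m then U else setT).
  have m0 : m != 0 by apply: contraNneq neq => ->.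
  split=> [n|n y ny|y].
  - case: ifP => _; first exact: borel_open.
    by case: ifP => _; [exact: borel_open|exact: (Scst True)].
  - case: eqP => [n0|_].
      by apply: tV; rewrite -n0; apply: pieces_sub ny; rewrite leq_maxr.
    case: eqP => [nm|//].
    by apply: tU; rewrite -nm; apply: pieces_sub ny; rewrite leq_maxl.
  - have [Vy|Vy] := pselect (V y); last by exists 0.
    exists m; rewrite (negbTE m0) eqxx => Uy.
    by rewrite -[False]/(set0 y) -UV.
have [M MP] := fibre_bound i0 (p (b 0)).
have [BM Mb _] := bP M.
suff : (phi i0 (b M) < M)%N by rewrite ltnNge Mb.
apply: MP => //; apply/eqP.
by apply: contrapT => /negP neq; apply: same; exists M.
Qed.

Lemma novikov : exists E : nat -> set Y, [/\ forall m, borel (E m),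
  forall b, B b -> E (phi i0 b) (p b) &
  forall y, exists m, forall n, (m <= n)%N -> ~ E n y].
Proof.
have [E [Eb BE Eempty]] := pieces_separated.
exists (fun m => [set y | forall j, (j <= m)%N -> E j y]); split=> [m|b Bb j|y].
- by apply: Sall => j; apply: Simp (Scst _) (Eb j).
- by move=> jb; apply: BE; exists b.
- by have [m Em] := Eempty y; exists m => n mn; move/(_ m mn).
Qed.

End Novikov.

(** The Borel sets [E i] bound each coordinate of the points of [B] above [y]
    by a number depending on [y]. By compactness of the resulting tree, [y] lies
    in the image as soon as, at every depth, it lies in the closure of the image
    of one of the finitely many cells allowed by the bounds; and this condition
    is Borel. *)
Theorem borel_image : borel (p @` B).
Proof.
have /choice[E EP] := novikov.
pose cell s := [set y | exists b,
  [/\ B b, p b = y & forall i, (i < size s)%N -> phi i b = nth 0 s i]].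
pose Q y s := closure (cell s) y /\
  forall i, (i < size s)%N -> E i (nth 0 s i) y.
have -> : p @` B = [set y | forall n, exists s, size s = n /\ Q y s].
  apply/seteqP; split=> [_ [b Bb <-] n|y yP].
    exists (mkseq (phi^~ b) n); rewrite size_mkseq; split=> //; split.
      apply: subset_closure; exists b; split=> // i.
      by rewrite size_mkseq => in_; rewrite nth_mkseq.
    move=> i; rewrite size_mkseq => in_; rewrite nth_mkseq //.
    by have [_ + _] := EP i; apply.
  have /choice[w wP] i : exists m, forall n, (m <= n)%N -> ~ E i n y.
    by have [_ _] := EP i; apply.
  have [s k|s k [_ Esk]|//|z zP] := @konig (Q y) w.
  - move=> [cl Es]; split=> [|i si].
      apply: closureS cl => x [b [Bb bx bs]]; exists b; split=> // i si.
      by rewrite bs ?size_rcons ?ltnS 1?ltnW // nth_rcons si.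
    by have := Es i; rewrite size_rcons ltnS ltnW // nth_rcons si; apply.
  - rewrite ltnNge; apply/negP => /wP; apply.
    have := Esk (size s).
    by rewrite size_rcons ltnSn nth_rcons ltnn eqxx; apply.
  have /choice[u uP] n : exists b, [/\ B b, ball y n.+1%:R^-1%R (p b) &
      forall i, (i < n)%N -> phi i b = z i].
    have [cl _] := zP n.
    have [|_ [[b [Bb <- bz]] yb]] := cl (ball y n.+1%:R^-1%R).
      by apply: nbhsx_ballx; rewrite invr_gt0.
    exists b; split=> // i in_.
    by rewrite bz ?size_mkseq // nth_mkseq.
  have [n|i|b [Bb ub _]] := @phiB u z.
  - by have [] := uP n.
  - by exists i.+1 => n in_; have [_ _] := uP n; apply.
  exists b => //; apply: tends_uniq hY (tends_image ub) _.
  move=> V /nbhs_ballP[e /= e0 yV].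
  have [N _ Ne] := near_infty_natSinv_lt (PosNum e0).
  exists N => n Nn; apply: yV; have [_ yu _] := uP n.
  exact: le_ball (ltW (Ne n Nn)) _ yu.
apply: Sall => n; apply: Sex => s; apply: Sand; first exact: Scst.
apply: Sand; first by apply: borel_closed; exact: closed_closure.
apply: Sall => i; apply: Simp; first exact: Scst.
by have [Eb _ _] := EP i; exact: Eb.
Qed.

End Projection.

(** * Reading the definition of two ends *)

Section Ends.
Variables (X : choiceType) (G : set (X * X)).
Hypothesis Gsym : forall x y, G (x, y) -> G (y, x).
Hypothesis Gfin : locally_finite G.
Hypothesis G2 : forall C, components setT G C -> component_has_ends G C 2.
Local Notation conn := (conn G).
Local Notation clos R := (clos_refl_sym_trans X (fun u v => R (u, v))).

Lemma clos_rst_sub (R R' : X -> X -> Prop) x y :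
  (forall u v, R u v -> R' u v) ->
  clos_refl_sym_trans X R x y -> clos_refl_sym_trans X R' x y.
Proof.
move=> RR'; elim=> [u v /RR'|u|u v _|u v w _ uv _].
- exact: rst_step.
- exact: rst_refl.
- exact: rst_sym.
- exact: rst_trans uv.
Qed.

Lemma conn_clos W x y :
  conn W x y <->
  clos_refl_sym_trans X (fun u v => [/\ G (u, v), W u & W v]) x y.
Proof.
split=> [xy|].
  apply: (@conn_closed _ _ _ (clos_refl_sym_trans X
    (fun u v => [/\ G (u, v), W u & W v]) x) x y _ xy); last exact: rst_refl.
  by move=> u v uv Wu Wv _ xu; apply: rst_trans xu (rst_step _ _ _ _ _).
elim=> [u v [uv Wu Wv]|u|u v _|u v w _ uv _].
- exact: conn_edge.
- exact: conn_refl.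
- exact: conn_sym.
- exact: conn_trans uv.
Qed.

Lemma component_conn x : components setT G (conn setT x).
Proof.
exists x => //; apply/seteqP; split=> y.
  by move=> xy; apply/conn_clos; apply: clos_rst_sub xy.
by move=> /conn_clos; apply: clos_rst_sub => u v [].
Qed.

Lemma parts_conn x F y : conn setT x y -> ~ F y ->
  [set z | clos (restrict_graph (restrict_graph G (conn setT x))
                  (conn setT x `\` F)) y z] = conn (~` F) y.
Proof.
move=> xy Fy; apply/seteqP; split=> z.
  move=> yz; apply/conn_clos; apply: clos_rst_sub yz => u v.
  by move=> [[uv _] [[_ Fu] [_ Fv]]].
move=> yz; suff [] : conn setT x z /\
    clos (restrict_graph (restrict_graph G (conn setT x))
       (conn setT x `\` F)) y z by [].
apply: (@conn_closed _ _ _ [set z | conn setT x z /\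
    clos (restrict_graph (restrict_graph G (conn setT x))
       (conn setT x `\` F)) y z] y z _ yz); last by split=> //; exact: rst_refl.
move=> u v uv Fu Fv _ [xu yu].
have xv : conn setT x v by apply: conn_trans xu (conn_edge uv _ _).
split=> //; apply: rst_trans yu (rst_step _ _ _ _ _).
by split.
Qed.

(** The same set as in the definition of [divides], for the component of [x],
    written with components of the complement of [F] in the whole graph. *)
Definition parts x F := [set K | exists y,
  [/\ conn setT x y, inf_comp G (~` F) y & K = conn (~` F) y]].

Lemma parts_components x F :
  [set K | components (conn setT x `\` F)
     (restrict_graph (restrict_graph G (conn setT x)) (conn setT x `\` F)) K /\
     infinite_set K] = parts x F.
Proof.
apply/seteqP; split=> K.
  move=> [[y [xy Fy] <-]]; rewrite parts_conn // => inf.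
  by exists y.
move=> [y [xy [Fy inf] ->]]; split=> //.
by exists y => //; exact: parts_conn.
Qed.

Lemma splits_ex x : exists2 F, finite_set F & splits G F x.
Proof.
have [[F [Ffin _ FC]] _] := G2 (component_conn x).
exists F => //; move: FC; rewrite /divides parts_components.
move=> /card_set_bijP[f [_ _ fsurj]].
have [K [y [xy yi ->]] fK] := fsurj 0 isT.
have [L [z [xz zi ->]] fL] := fsurj 1 isT.
exists y, z; split=> // yz.
suff e : conn (~` F) y = conn (~` F) z by rewrite e fL in fK.
apply/seteqP; split=> w.
  by apply: conn_trans; exact: conn_sym.
exact: conn_trans.
Qed.

Lemma two_sides F : finite_set F -> at_most_two_sides G F.
Proof.
move=> Ffin x y z xy xz xi yi zi.
apply: contrapT => no.
pose F' := F `&` conn setT x.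
have F'E u : conn setT x u -> conn (~` F') u = conn (~` F) u.
  move=> xu; apply/seteqP; split=> w; apply: conn_sub => v uv.
    move=> nF' Fv; apply: nF'; split=> //.
    exact: conn_trans xu (conn_setT uv).
  by move=> nF [].
have F'inf u : conn setT x u -> inf_comp G (~` F) u -> inf_comp G (~` F') u.
  by move=> xu [Fu ui]; split; [move=> []|rewrite F'E].
have F'fin : finite_set F' by exact: finite_setIl.
have [f Ff xf] : exists2 f, F f & conn setT x f.
  apply: contrapT => nof; apply: no; apply: Or31.
  apply: conn_sub xy => v xv _ Fv.
  by apply: nof; exists v => //; apply: conn_setT xv.
have partsfin : finite_set (parts x F').
  apply: (@sub_finite_set _ _
      (conn (~` F') @` \bigcup_(g in F') [set w | G (g, w)])).
    move=> K [u [xu [F'u _] ->]].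
    have [//|w [uw F'w [g F'g wg]]] := @conn_exit _ G F' u f
      (conn_trans (conn_sym Gsym xu) xf) _ F'u.
    exists w; first by exists g => //; apply: Gsym.
    apply/seteqP; split=> v; first exact: conn_trans.
    by apply: conn_trans; exact: conn_sym.
  by apply: finite_image; apply: bigcup_finite => // g _; exact: Gfin.
have [m mP] := (finite_setP _).1 partsfin.
have [_ /(_ m)] := G2 (component_conn x); apply; last first.
  exists F'; split=> //; first by move=> v [].
  by rewrite /divides parts_components.
move: mP => /card_set_bijP[h [hm hinj _]].
have pt u : conn setT x u -> inf_comp G (~` F) u -> parts x F' (conn (~` F) u).
  by move=> xu ui; exists u; split=> //; [exact: F'inf|rewrite F'E].
have px := pt x (conn_refl _ _ _) xi.
have py := pt y xy yi; have pz := pt z xz zi.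
have neq u v : parts x F' (conn (~` F) u) -> parts x F' (conn (~` F) v) ->
    ~ conn (~` F) u v -> h (conn (~` F) u) <> h (conn (~` F) v).
  move=> pu pv uv /hinj; rewrite !inE => /(_ pu pv) e; apply: uv.
  by rewrite e; exact: conn_refl.
have := neq _ _ px py (fun c => no (Or31 _ _ c)).
have := neq _ _ px pz (fun c => no (Or32 _ _ c)).
have := neq _ _ py pz (fun c => no (Or33 _ _ c)).
have := hm _ px; have := hm _ py; have := hm _ pz; rewrite /=.
lia.
Qed.

End Ends.

(** * Finite discrete spaces *)

(** The metric, hence the topology, depends on the type [R] of distances, so [R] is
    a parameter of the carrier. *)
Definition discrete_ord (R : realType) (n : nat) : Type := 'I_n.

Section DiscreteOrdinal.
Variables (R : realType) (n : nat).

HB.instance Definition _ := Finite.on (discrete_ord R n).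

Let d (x y : discrete_ord R n) : R := (x != y)%:R%R.

Let dxx x : d x x = 0%R. Proof. by rewrite /d eqxx. Qed.

Let d_eq x y : d x y = 0%R -> x = y.
Proof. by rewrite /d; case: eqP => // _ /eqP; rewrite oner_eq0. Qed.

Let d_sym x y : d x y = d y x. Proof. by rewrite /d eq_sym. Qed.

Let d_triangle y x z : (d x z <= d x y + d y z)%R.
Proof.
rewrite /d; case: (x =P y) => [->|_] /=; first by rewrite add0r.
by apply: (@le_trans _ _ 1%R); [rewrite lern1 leq_b1|rewrite lerDl ler0n].
Qed.

HB.instance Definition _ :=
  isMetric.Build R (discrete_ord R n) dxx d_eq d_sym d_triangle.


Lemma ball_discrete (x y : discrete_ord R n) : ball x 1%R y -> x = y.
Proof.
by rewrite ballEmdist /= /mdist /= /d; case: eqP => // _; rewrite ltxx.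
Qed.

Lemma polish_discrete_ord : polish R (discrete_ord R n).
Proof.
split.
  exists setT; first exact: finite_set_countable finite_finset.
  by move=> O [x Ox] _; exists x.
exists (discrete_ord R n); last by exists id, id; split=> // x.
move=> F FF /cauchyP/(_ 1%R ltr01)[x Fx]; exists x => V /nbhs_singleton Vx.
by apply: filterS Fx => y /ball_discrete <-.
Qed.

End DiscreteOrdinal.

Lemma borel_colorable_of_nat (R : realType) (X : topologicalType)
    (G : set (X * X)) n (c : X -> nat) :
  (forall a, borel [set x | c x = a]) -> (forall x, (c x < n)%N) ->
  coloring G c -> borel_colorable R G n.
Proof.
move=> cb cn col.
exists (discrete_ord R n), (fun x => Ordinal (cn x)); split.
- exact: polish_discrete_ord.
- apply/card_set_bijP; exists (@nat_of_ord n); split.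
  + by move=> i _ /=; exact: ltn_ord.
  + by move=> i j _ _; exact: val_inj.
  + by move=> i /= lin; exists (Ordinal lin).
- by move=> x y xy [] /(col _ _ xy).
- move=> B _; apply: (@sigma_ext _ (@borel X) _
    (fun x => exists i : 'I_n, B i /\ c x = i)).
    move=> x; split=> [Bx|[i [Bi ci]]] /=; first by exists (Ordinal (cn x)).
    by rewrite (_ : Ordinal _ = i) //; apply: val_inj.
  apply: (sigma_ex (@borel0 X) (@borel_bigcup X)) => i.
  apply: (sigma_and (@borel0 X) (@borelC X) (@borel_bigcup X)); last exact: cb.
  exact: (sigma_cst (@borel0 X) (@borelC X)).
Qed.

(** * Neighborhoods of Borel sets in a Polish space *)

Section Polish.
Variables (R : realType) (X : topologicalType) (M : metricType R).
Variables (f : X -> M) (g : M -> X).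
Hypothesis fc : continuous f.
Hypothesis gc : continuous g.
Hypothesis fK : cancel f g.
Hypothesis gK : cancel g f.
Hypothesis Xsep : Defs.separable X.
Hypothesis Mc : complete_metric M.

Lemma separable_image : Defs.separable M.
Proof.
have [D Dc Dd] := Xsep; exists (f @` D).
  exact: card_le_trans (card_image_le _ _) Dc.
move=> O [y Oy] oO; have [||x [Ox Dx]] := Dd (f @^-1` O) _ _.
- by exists (g y); rewrite /= gK.
- by move/continuousP: fc; apply.
by exists (f x); split=> //; exists x.
Qed.

Lemma isolating_sets : exists U : nat -> set X, (forall n, borel (U n)) /\
  forall F x, finite_set F ->
    exists n, U n x /\ forall y, F y -> U n y -> y = x.
Proof.
have [W [Wopen Wex Wball]] := small_open_cover separable_image.
exists (fun n => if unpickle n is Some ij then f @^-1` W ij.1 ij.2 else set0).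
split=> [n|F x Ffin].
  case: unpickle => [[i j]|]; last exact: borel0.
  by apply: borel_open; move/continuousP: fc; apply.
have /(closed_openC) : closed (f @` (F `\ x)).
  move: (hausdorff_accessible (@metric_hausdorff R M)).
  move=> /accessible_finite_set_closed; apply.
  by apply: finite_image; apply: finite_setD.
move=> oF.
have [|e /= e0 xF] := (nbhs_ballP (f x) _).1 (open_nbhs_nbhs (conj oF _)).
  by move=> [y [Fy yx] fyx]; apply: yx; rewrite /= -(fK x) -fyx fK.
have [i _ ie] := near_infty_natSinv_lt (PosNum e0).
have [j Wx] := Wex i (f x).
exists (pickle (i, j)); rewrite pickleK; split=> // y Fy Wy.
apply: contrapT => yx; apply: (xF (f y)); last by exists y.
exact: le_ball (ltW (ie i (leqnn _))) _ (Wball _ _ _ _ Wx Wy).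
Qed.

Lemma hausdorff_pair : hausdorff_space (M * M)%type.
Proof.
move=> [a b] [c d] cl; congr pair; apply: (@metric_hausdorff R M).
  move=> A B Aa Bc; have [||[u v] [[/= Au _] [/= Bu _]]] :=
    cl (A `*` setT) (B `*` setT); last by exists u.
  - by exists (A, setT) => //; split=> //; exact: filterT.
  - by exists (B, setT) => //; split=> //; exact: filterT.
move=> A B Ab Bd; have [||[u v] [[/= _ Av] [/= _ Bv]]] :=
  cl (setT `*` A) (setT `*` B); last by exists v.
- by exists (setT, A) => //; split=> //; exact: filterT.
- by exists (setT, B) => //; split=> //; exact: filterT.
Qed.

Variable G : set (X * X).
Hypothesis Gsym : forall x y, G (x, y) -> G (y, x).
Hypothesis Gfin : locally_finite G.
Hypothesis Gborel : borel G.

(** The set of neighbors of [A] is the image, under the second projection, of the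
    Borel set of edges that start in [A]; local finiteness bounds the fibers. *)
Lemma borel_nbr A : borel A -> borel (nbr G A).
Proof.
move=> Ab.
pose B := [set ab : M * M | G (g ab.1, g ab.2) /\ A (g ab.1)].
have fstc : continuous (@fst M M) by move=> x; exact: cvg_fst.
have sndc : continuous (@snd M M) by move=> x; exact: cvg_snd.
have Bb : borel B.
  apply: (sigma_and (@borel0 _) (@borelC _) (@borel_bigcup _)).
    apply: (@borel_preimage _ _
      (fun ab : M * M => (g ab.1, g ab.2)) _ G Gborel).
    move=> x; apply: cvg_pair.
      by apply: continuous_comp; [exact: fstc|exact: gc].
    by apply: continuous_comp; [exact: sndc|exact: gc].
  apply: (@borel_preimage _ _ (g \o fst) _ A Ab).
  by move=> x; apply: continuous_comp; [exact: fstc|exact: gc].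
have cM := coded_complete Mc separable_image.
have [phi phiB] := coded_borel hausdorff_pair (coded_prod cM cM) Bb.
have -> : nbr G A = f @^-1` (snd @` B).
  apply/seteqP; split=> [y [x Ax xy]|y [[a b] /= [ab Aa] bfy]].
    by exists (f x, f y) => //; split=> /=; rewrite !fK.
  by exists (g a) => //; rewrite -(fK y) -bfy.
apply: borel_preimage => //.
apply: (borel_image hausdorff_pair (@metric_hausdorff R M) sndc phiB).
move=> b; apply: (@sub_finite_set _ _
    ((fun x => (f x, b)) @` [set x | G (g b, x)])).
  move=> [a b'] [[/= ab _] <-]; exists (g a); first exact: Gsym.
  by rewrite gK.
exact: finite_image.
Qed.

End Polish.

Theorem theorem2 (R : realType) (X : topologicalType) (G : set (X * X)) (k : nat) :
  polish R X ->
  is_graph G ->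
  locally_finite G ->
  borel G ->
  chromatic_number G k ->
  (forall C : set X, components [set: X] G C -> component_has_ends G C 2) ->
  exists2 b : nat, borel_chromatic_number R G b & (b <= 2 * k - 1)%N.
Proof.
move=> [Xsep [M Mc [f [g [fc gc fK gK]]]]] [Gsym Girr] Gfin Gborel.
move=> [[Y0 [c [/card_set_bijP[h [hk hinj _]] ccol]]] _] ends.
have [U [Uborel Uiso]] := isolating_sets fc fK gK Xsep.
have [c' [c'borel c'k c'col]] : exists c' : X -> nat,
    [/\ forall a, borel [set x | c' x = a],
        forall x, (c' x < 2 * k - 1)%N & coloring G c'].
  apply: (@definable_coloring X G Gsym Girr Gfin (@borel X) U (@borel0 X)
    (@borelC X) (@borel_bigcup X) Uborel Uiso _ k (h \o c)).
  - exact: borel_nbr fc gc fK gK Xsep Mc G Gsym Gfin Gborel.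
  - exact: splits_ex.
  - exact: two_sides.
  - by move=> x; exact: hk.
  - move=> x y /ccol xy /hinj; rewrite !inE => /(_ I I); exact: xy.
have colorable := borel_colorable_of_nat R c'borel c'k c'col.
have [b [bcol bmin]] := least_nat (ex_intro _ _ colorable).
by exists b; [split|exact: bmin].
Qed.
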